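(* A localised eigenmode $u$ of the Helmholtz problem $\mathcal{L}u=\omega^2u$, posed on a medium constituted by the two semi-infinite arrays of the materials $A$ and $B$, and its associated eigenfrequency $\omega$ must satisfy $$u(x_n)=O\big(|\lambda_1^{[A]}(\omega)|^{|n|}\big)\quad\text{and}\quad u'(x_n)=O\big(|\lambda_1^{[A]}(\omega)|^{|n|}\big)\quad\text{as } n\to-\infty,$$ $$u(x_n)=O\big(|\lambda_1^{[B]}(\omega)|^{|n|}\big)\quad\text{and}\quad u'(x_n)=O\big(|\lambda_1^{[B]}(\omega)|^{|n|}\big)\quad\text{as } n\to+\infty,$$ where $\lambda_1^{[A]}$ is the eigenvalue of $T_p^{[A]}$ satisfying $|\lambda_1^{[A]}(\omega)|<1$ and $\lambda_1^{[B]}$ is the eigenvalue of $T_p^{[B]}$ satisfying $|\lambda_1^{[B]}(\omega)|<1$.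
   Context: Setting. $\mu_0>0$ is a constant and $\varepsilon_1,\varepsilon_2$ are real-valued continuous functions of the frequency $\omega\in\mathbb{R}$, finite and non-zero at the frequencies considered. For each material $j\in\{A,B\}$ the unit cell $[0,1]$ is divided into consecutive intervals in the order $D^{[1]}_1,D^{[2]}_1,D^{[1]}_2,\dots,D^{[2]}_N,D^{[1]}_{N+1}$ (the geometry depends on $j$); $\varepsilon^{j}(x,\omega)$ is $1$-periodic in $x$, equal to $\varepsilon_1(\omega)$ on the $D^{[1]}_i$ and to $\varepsilon_2(\omega)$ on the $D^{[2]}_i$, and mirror symmetric, $\varepsilon^{j}(x,\omega)=\varepsilon^{j}(1-x,\omega)$ for $x\in[0,1]$. The full structure has $\varepsilon=\varepsilon^{A}$ for $x<0$ and $\varepsilon=\varepsilon^{B}$ for $x>0$. The endpoints of the periodic cells are $x_n=n$, $n\in\mathbb{Z}$, and the interface is $x_0=0$. The operator is $\mathcal{L}u=-\frac{1}{\mu_0}\frac{d}{dx}\left(\frac{1}{\varepsilon(x,\omega)}\frac{du}{dx}\right)$, with $u$ and $\frac1\varepsilon u'$ continuous. A localised eigenmode with eigenfrequency $\omega$ is a non-zero solution $u$ of $\mathcal{L}u=\omega^2u$ on $\mathbb{R}$ with $u(x_n)\to0$ and $u'(x_n)\to0$ as $n\to\pm\infty$. Transfer matrices. $T_p^{[j]}=T_p^{[j]}(\omega)$ is the $2\times2$ transfer matrix over one periodic cell of material $j$: for every solution $u$ of the equation in material $j$, $(u(x_{n+1}),u'(x_{n+1}))^\top=T_p^{[j]}(u(x_n),u'(x_n))^\top$.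 It has determinant $1$. *)

(* Defs.v *)
From Stdlib Require Import Reals ZArith.
From Coquelicot Require Import Coquelicot.
Open Scope R_scope.

(** The nodes [0 = p_0 < p_1 < ... < p_(2N+1) = 1] cut the unit cell into the
    consecutive layers [D1_1, D2_1, D1_2, ..., D2_N, D1_(N+1)]. *)
Record geometry := Geometry {
  inclusions : nat;
  node : nat -> R;
  inclusions_pos : (1 <= inclusions)%nat;
  node_first : node 0 = 0;
  node_last : node (2 * inclusions + 1) = 1;
  node_lt : forall i : nat, (i < 2 * inclusions + 1)%nat -> node i < node (S i)
}.

(** The layers [D1] are closed and the layers [D2] are open, so that they
    partition [[0,1]] and mirror symmetry can hold at every point, nodes
    included (half-open layers would break it there).  The index [i] starts
    at 0. *)
Definition in_D1 (g : geometry) (x : R) : Prop :=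
  exists i : nat, (i <= inclusions g)%nat /\
    node g (2 * i) <= x <= node g (2 * i + 1).

Definition in_D2 (g : geometry) (x : R) : Prop :=
  exists i : nat, (i < inclusions g)%nat /\
    node g (2 * i + 1) < x < node g (2 * i + 2).

(** [eps x omega] is the permittivity at position [x] and frequency [omega]. *)
Record material_permittivity (g : geometry) (eps1 eps2 : R -> R)
    (eps : R -> R -> R) : Prop := {
  permittivity_periodic : forall x omega, eps (x + 1) omega = eps x omega;
  permittivity_D1 : forall x omega, in_D1 g x -> eps x omega = eps1 omega;
  permittivity_D2 : forall x omega, in_D2 g x -> eps x omega = eps2 omega;
  permittivity_mirror :
    forall x omega, 0 <= x <= 1 -> eps x omega = eps (1 - x) omega
}.

(** At [x = 0] both materials take the value [eps1 omega], so it does not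
    matter on which side the interface point is put. *)
Definition joined_permittivity (epsA epsB : R -> R -> R) (x omega : R) : R :=
  if Rlt_dec x 0 then epsA x omega else epsB x omega.

(** Derivative of a complex-valued function of a real variable; as for
    [Derive], it is meaningful only where the function is differentiable. *)
Definition CDerive (u : R -> C) (x : R) : C :=
  (Derive (fun t => Re (u t)) x, Derive (fun t => Im (u t)) x).

Definition flux (eps : R -> R) (u : R -> C) (x : R) : C :=
  (RtoC (/ eps x) * CDerive u x)%C.

Definition helmholtz_op (mu0 : R) (eps : R -> R) (u : R -> C) (x : R) : C :=
  (RtoC (- / mu0) * CDerive (flux eps u) x)%C.

(** The differential equation is imposed at the points where [eps] is
    continuous, i.e. everywhere except at the jumps of the piecewise constant
    permittivity, where [u'] need not exist.  There, continuity of
    [(1/eps) u'] means that it extends to a continuous function [w] on [R]. *)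
Definition helmholtz_solution (mu0 : R) (eps : R -> R) (omega : R)
    (u : R -> C) : Prop :=
  (forall x, @continuous R_UniformSpace C_R_NormedModule u x) /\
  (exists w : R -> C,
     (forall x, @continuous R_UniformSpace C_R_NormedModule w x) /\
     (forall x, continuous eps x -> flux eps u x = w x)) /\
  (forall x, continuous eps x ->
     @ex_derive R_AbsRing C_R_NormedModule u x /\
     @ex_derive R_AbsRing C_R_NormedModule (flux eps u) x /\
     helmholtz_op mu0 eps u x = (RtoC (omega ^ 2) * u x)%C).

Definition Z_p_infty (P : Z -> Prop) : Prop :=
  exists M : Z, forall n : Z, (M <= n)%Z -> P n.

Definition Z_m_infty (P : Z -> Prop) : Prop :=
  exists M : Z, forall n : Z, (n <= M)%Z -> P n.

Definition is_bigO (F : (Z -> Prop) -> Prop) (f : Z -> C) (g : Z -> R) : Prop :=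
  exists K : R, F (fun n => Cmod (f n) <= K * Rabs (g n)).

Definition localised_eigenmode (mu0 : R) (eps : R -> R) (omega : R)
    (u : R -> C) : Prop :=
  helmholtz_solution mu0 eps omega u /\
  (exists x, u x <> RtoC 0) /\
  filterlim (fun n : Z => u (IZR n)) Z_p_infty
    (@locally C_R_NormedModule (RtoC 0)) /\
  filterlim (fun n : Z => CDerive u (IZR n)) Z_p_infty
    (@locally C_R_NormedModule (RtoC 0)) /\
  filterlim (fun n : Z => u (IZR n)) Z_m_infty
    (@locally C_R_NormedModule (RtoC 0)) /\
  filterlim (fun n : Z => CDerive u (IZR n)) Z_m_infty
    (@locally C_R_NormedModule (RtoC 0)).

Definition state (u : R -> C) (x : R) : @matrix C 2 1 :=
  mk_matrix 2 1 (fun i _ => match i with O => u x | _ => CDerive u x end).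

Definition is_transfer_matrix (mu0 : R) (eps : R -> R) (omega : R)
    (T : @matrix C 2 2) : Prop :=
  forall u : R -> C, helmholtz_solution mu0 eps omega u ->
  forall n : Z, state u (IZR (n + 1)) = Mmult T (state u (IZR n)).

Definition is_eigenvalue (T : @matrix C 2 2) (lambda : C) : Prop :=
  exists v : @matrix C 2 1, v <> Mzero /\
    Mmult T v =
      mk_matrix 2 1 (fun i j => (lambda * coeff_mat (RtoC 0) v i j)%C).

Definition is_lambda1 (T : @matrix C 2 2) (lambda : C) : Prop :=
  unique (fun z : C => is_eigenvalue T z /\ Cmod z < 1) lambda.

(* Main.v *)
Require Import Defs.
From Stdlib Require Import Reals ZArith Lra Lia.
From Coquelicot Require Import Coquelicot.
Open Scope R_scope.

(** Write the Helmholtz equation as the first-order system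
    [U' = eps P], [P' = - q U] with [q = mu0 * omega ^ 2], where [P = U' / eps]
    is the flux; its coefficients are real, so real and imaginary parts may be
    treated separately.  Two facts carry the argument.

    Analysis.  The Wronskian [U Q - V P] of two solutions is continuous and has
    derivative [0] inside each layer, hence is constant ([wronskian_const]).
    Solutions with prescribed data at [0] exist: on the right half-line they
    are obtained by propagating explicitly from layer to layer, and on the left
    one by reflection, since a mirror symmetric periodic permittivity is an even
    function ([line_solution_solves]).  Applied to the two fundamental
    solutions, constancy of the Wronskian gives uniqueness on the half-line
    ([half_line_unique]) and [det T = 1] for the transfer matrix
    ([transfer_det]).  An eigenmode of the joined structure solves the equation
    of [B] on the right half-line, so it coincides there with a solution of [B]
    on the whole line and is advanced by [TB] from node to node
    ([transfer_right]); in the same way it is advanced by [TA] on the left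
    ([transfer_left]).

    Algebra.  Let [s_(n+1) = T s_n] be an orbit in [C^2] with [det T = 1],
    [s_0 <> 0] and [s_n -> 0].  The determinant of [(s_n, s_(n+1))] does not
    depend on [n] and tends to [0], so it vanishes: [s_0] is an eigenvector, for
    some eigenvalue [lambda], and [s_n = lambda ^ n s_0] forces
    [Cmod lambda < 1] ([decaying_orbit]).  The other eigenvalue is [1 / lambda],
    so [lambda] is the only one of modulus less than [1].  On the left the same
    applies to the inverse of [TA], which is its adjugate and has the same
    characteristic polynomial.

    The orbit is not zero because an eigenmode with zero data at the interface
    would vanish on both half-lines.  The bounds follow, the constants being the
    moduli of the eigenmode and of its derivative at [0]. *)

(** * Local limits, gluing and reflection *)

Lemma locally_between (a b x : R) (P : R -> Prop) :
  a < x < b -> (forall t, a < t < b -> P t) -> locally x P.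
Proof.
  intros [Ha Hb] H.
  apply (locally_interval P x a b); simpl; auto.
Qed.

(** A property that holds near [x] holds at points of [(a, x)]. *)
Lemma locally_point_left (x : R) (P : R -> Prop) :
  locally x P -> forall a, a < x -> exists t, a < t < x /\ P t.
Proof.
  intros [d Hd] a Ha.
  assert (Hd0 := cond_pos d).
  exists (x - Rmin (d / 2) ((x - a) / 2)).
  assert (H1 := Rmin_l (d / 2) ((x - a) / 2)).
  assert (H2 := Rmin_r (d / 2) ((x - a) / 2)).
  assert (H3 : 0 < Rmin (d / 2) ((x - a) / 2)) by (apply Rmin_pos; lra).
  split; [lra|]. apply Hd.
  unfold ball; simpl; unfold AbsRing_ball, abs, minus, plus, opp; simpl.
  apply Rabs_def1; lra.
Qed.

Lemma locally_opp (x : R) (P : R -> Prop) :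
  locally (- x) P -> locally x (fun t => P (- t)).
Proof.
  intros H.
  apply (continuous_opp (V := R_NormedModule) (fun t => t) x (continuous_id x)).
  exact H.
Qed.

Lemma locally_point_right (x : R) (P : R -> Prop) :
  locally x P -> forall b, x < b -> exists t, x < t < b /\ P t.
Proof.
  intros H b Hb.
  destruct (locally_point_left (- x) (fun t => P (- t))) with (a := - b)
    as [t [Ht HP]].
  - apply locally_opp. rewrite Ropp_involutive. exact H.
  - lra.
  - exists (- t). split; [lra|exact HP].
Qed.

(** A function that near [x] takes at each point the value of one of two
    functions with equal value and derivative at [x] has this derivative too. *)
Lemma is_derive_glue (f g h : R -> R) (x l : R) :
  is_derive g x l -> is_derive h x l -> f x = g x -> f x = h x ->
  locally x (fun t => f t = g t \/ f t = h t) -> is_derive f x l.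
Proof.
  intros [Lg Hg] [_ Hh] Eg Eh Hloc. split; [exact Lg|].
  intros y Hy.
  assert (y = x) as -> by (symmetry; apply (is_filter_lim_locally_unique x y Hy)).
  intros eps.
  specialize (Hg x Hy eps). specialize (Hh x Hy eps).
  generalize (filter_and _ _ Hloc (filter_and _ _ Hg Hh)).
  apply filter_imp. intros t [[E|E] [H1 H2]].
  - rewrite E, Eg. exact H1.
  - rewrite E, Eh. exact H2.
Qed.

Lemma continuous_glue (f g h : R -> R) (x : R) :
  continuous g x -> continuous h x -> f x = g x -> f x = h x ->
  locally x (fun t => f t = g t \/ f t = h t) -> continuous f x.
Proof.
  intros Hg Hh Eg Eh Hloc P HP.
  assert (Pg := Hg P). assert (Ph := Hh P).
  rewrite <- Eg in Pg. rewrite <- Eh in Ph.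
  specialize (Pg HP). specialize (Ph HP). unfold filtermap in *.
  generalize (filter_and _ _ Hloc (filter_and _ _ Pg Ph)).
  apply filter_imp. intros t [[E|E] [H1 H2]]; rewrite E; assumption.
Qed.

Lemma is_derive_continuous (f : R -> R) (x l : R) :
  is_derive f x l -> continuous f x.
Proof.
  intros H. apply (ex_derive_continuous (V := R_NormedModule) f x).
  now exists l.
Qed.

Lemma is_derive_reflect (f : R -> R) (x l : R) :
  is_derive f (- x) l -> is_derive (fun t => f (- t)) x (- l).
Proof.
  intros H.
  replace (- l) with (scal (-1) l)
    by (unfold scal; simpl; unfold mult; simpl; ring).
  apply (is_derive_comp f Ropp x l (-1)); [exact H|].
  auto_derive; auto.
Qed.

Lemma continuous_reflect (f : R -> R) (x : R) :
  continuous f (- x) -> continuous (fun t => f (- t)) x.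
Proof.
  intros H. apply (continuous_comp Ropp f); [|exact H].
  apply (continuous_opp (V := R_NormedModule) (fun t => t)), continuous_id.
Qed.

(** * Locally constant coefficients *)

(** On a piecewise constant coefficient, this holds exactly away from the
    jumps. *)
Definition locally_constant (eps : R -> R) (x : R) : Prop :=
  locally x (fun t => eps t = eps x).

Lemma locally_constant_const (e x : R) : locally_constant (fun _ => e) x.
Proof. unfold locally_constant. apply filter_forall. auto. Qed.

Lemma locally_constant_right (eps : R -> R) (x b e : R) :
  x < b -> (forall t, x < t < b -> eps t = e) -> locally_constant eps x ->
  eps x = e.
Proof.
  intros Hb He Hl. destruct (locally_point_right x _ Hl b Hb) as [t [Ht E]].
  rewrite <- E. auto.
Qed.

Lemma locally_constant_left (eps : R -> R) (x a e : R) :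
  a < x -> (forall t, a < t < x -> eps t = e) -> locally_constant eps x ->
  eps x = e.
Proof.
  intros Hb He Hl. destruct (locally_point_left x _ Hl a Hb) as [t [Ht E]].
  rewrite <- E. auto.
Qed.

Lemma locally_constant_continuous (eps : R -> R) (x : R) :
  locally_constant eps x -> continuous eps x.
Proof.
  intros H. apply (continuous_ext_loc _ (fun _ => eps x)).
  - unfold locally_constant in H. revert H. apply filter_imp. auto.
  - apply continuous_const.
Qed.

Lemma locally_locally_constant (eps : R -> R) (x : R) :
  locally_constant eps x -> locally x (locally_constant eps).
Proof.
  intros H. assert (H2 := locally_locally _ _ H).
  generalize (filter_and _ _ H H2). apply filter_imp.
  intros t [E Ht]. unfold locally_constant. rewrite E. exact Ht.
Qed.

Lemma locally_value_constant (eps : R -> R) (x e : R) :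
  locally x (fun t => eps t = e) -> eps x = e /\ locally_constant eps x.
Proof.
  intros H. assert (E : eps x = e) by exact (locally_singleton x _ H).
  split; [exact E|]. unfold locally_constant. now rewrite E.
Qed.

(** For a coefficient that is constant on one side of [x], continuity at [x]
    determines the value there. *)
Lemma continuous_right_value (eps : R -> R) (x b e : R) :
  x < b -> (forall t, x < t < b -> eps t = e) -> continuous eps x -> eps x = e.
Proof.
  intros Hb He Hc. destruct (Req_dec (eps x) e) as [|Hne]; [auto|exfalso].
  assert (Hl : locally x (fun t => eps t <> e)).
  { apply (Hc (fun y => y <> e)). apply open_neq, Hne. }
  destruct (locally_point_right x _ Hl b Hb) as [t [Ht E]]. auto.
Qed.

Lemma continuous_left_value (eps : R -> R) (x a e : R) :
  a < x -> (forall t, a < t < x -> eps t = e) -> continuous eps x -> eps x = e.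
Proof.
  intros Ha He Hc. destruct (Req_dec (eps x) e) as [|Hne]; [auto|exfalso].
  assert (Hl : locally x (fun t => eps t <> e)).
  { apply (Hc (fun y => y <> e)). apply open_neq, Hne. }
  destruct (locally_point_left x _ Hl a Ha) as [t [Ht E]]. auto.
Qed.

(** * Complex-valued functions of a real variable *)

Lemma is_derive_Re (u : R -> C) (x : R) (l : C) :
  @is_derive R_AbsRing C_R_NormedModule u x l ->
  is_derive (fun t => Re (u t)) x (Re l).
Proof.
  intros H.
  apply (filterdiff_comp' (U := R_NormedModule) (V := C_R_NormedModule)
    (W := R_NormedModule) u fst x (fun y => scal y l) fst).
  - exact H.
  - apply filterdiff_linear.
    apply (is_linear_fst (U := R_NormedModule) (V := R_NormedModule)).
Qed.

Lemma is_derive_complex (f g : R -> R) (x a b : R) :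
  is_derive f x a -> is_derive g x b ->
  @is_derive R_AbsRing C_R_NormedModule (fun t => (f t, g t)) x (a, b).
Proof.
  intros Hf Hg.
  apply (filterdiff_comp'_2 (T := R_NormedModule) (U := R_NormedModule)
    (V := R_NormedModule) (W := C_R_NormedModule) f g (fun y z => (y, z)) x
    (fun y => scal y a) (fun y => scal y b) (fun y z => (y, z)));
    [exact Hf|exact Hg|].
  apply filterdiff_ext with (fun t => t); [intros []; reflexivity|].
  apply filterdiff_ext_lin with (fun t => t); [|intros []; reflexivity].
  apply filterdiff_id.
Qed.

Lemma continuous_complex (f g : R -> R) (x : R) :
  continuous f x -> continuous g x ->
  @continuous R_UniformSpace C_R_NormedModule (fun t => (f t, g t)) x.
Proof.
  intros Hf Hg.
  apply (continuous_comp_2 f g (fun y z => (y, z))); auto.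
  apply continuous_ext with (fun t => t); [intros []; reflexivity|].
  apply continuous_id.
Qed.

Lemma continuous_Re (u : R -> C) (x : R) :
  @continuous R_UniformSpace C_R_NormedModule u x ->
  continuous (fun t => Re (u t)) x.
Proof.
  intros H. apply (continuous_comp (V:= C_R_NormedModule) u fst); [exact H|].
  destruct (u x).
  apply (continuous_fst (U := R_UniformSpace) (V := R_UniformSpace)).
Qed.

Lemma is_derive_Im (u : R -> C) (x : R) (l : C) :
  @is_derive R_AbsRing C_R_NormedModule u x l ->
  is_derive (fun t => Im (u t)) x (Im l).
Proof.
  intros H.
  apply (filterdiff_comp' (U := R_NormedModule) (V := C_R_NormedModule)
    (W := R_NormedModule) u snd x (fun y => scal y l) snd).
  - exact H.
  - apply filterdiff_linear.
    apply (is_linear_snd (U := R_NormedModule) (V := R_NormedModule)).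
Qed.

Lemma continuous_Im (u : R -> C) (x : R) :
  @continuous R_UniformSpace C_R_NormedModule u x ->
  continuous (fun t => Im (u t)) x.
Proof.
  intros H. apply (continuous_comp (V:= C_R_NormedModule) u snd); [exact H|].
  destruct (u x).
  apply (continuous_snd (U := R_UniformSpace) (V := R_UniformSpace)).
Qed.

Lemma ex_derive_CDerive (u : R -> C) (x : R) :
  @ex_derive R_AbsRing C_R_NormedModule u x ->
  is_derive (fun t => Re (u t)) x (Re (CDerive u x)) /\
  is_derive (fun t => Im (u t)) x (Im (CDerive u x)).
Proof.
  intros [l Hl]. split; apply Derive_correct.
  - exists (Re l). now apply is_derive_Re.
  - exists (Im l). now apply is_derive_Im.
Qed.

Lemma is_derive_CDerive (u : R -> C) (x a b : R) :
  is_derive (fun t => Re (u t)) x a -> is_derive (fun t => Im (u t)) x b ->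
  CDerive u x = (a, b).
Proof.
  intros Ha Hb. unfold CDerive.
  apply f_equal2; now apply is_derive_unique.
Qed.

(** * The first-order system with constant coefficients *)

(** The solution of [c'' = k c] with [c 0 = 1] and [c' 0 = 0], for a
    coefficient [k] of any sign. *)
Definition cosk (k t : R) : R :=
  match total_order_T k 0 with
  | inleft (left _) => cos (sqrt (- k) * t)
  | inleft (right _) => 1
  | inright _ => cosh (sqrt k * t)
  end.

(** The solution of [s'' = k s] with [s 0 = 0] and [s' 0 = 1]. *)
Definition sink (k t : R) : R :=
  match total_order_T k 0 with
  | inleft (left _) => sin (sqrt (- k) * t) / sqrt (- k)
  | inleft (right _) => t
  | inright _ => sinh (sqrt k * t) / sqrt k
  end.

Lemma cosk_0 (k : R) : cosk k 0 = 1.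
Proof.
  unfold cosk. destruct (total_order_T k 0) as [[H|H]|H];
  rewrite ?Rmult_0_r, ?cos_0, ?cosh_0; reflexivity.
Qed.

Lemma sink_0 (k : R) : sink k 0 = 0.
Proof.
  unfold sink. destruct (total_order_T k 0) as [[H|H]|H];
  rewrite ?Rmult_0_r, ?sin_0, ?sinh_0; try reflexivity; unfold Rdiv; ring.
Qed.

Lemma is_derive_cosk (k t : R) : is_derive (cosk k) t (k * sink k t).
Proof.
  unfold cosk, sink. destruct (total_order_T k 0) as [[H|H]|H].
  - assert (0 < sqrt (- k)) by (apply sqrt_lt_R0; lra).
    assert (E := sqrt_sqrt (- k) ltac:(lra)).
    set (r := sqrt (- k)) in *. replace k with (- (r * r)) by lra.
    auto_derive; auto. field. lra.
  - subst. auto_derive; auto. ring.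
  - assert (0 < sqrt k) by (apply sqrt_lt_R0; lra).
    assert (E := sqrt_sqrt k ltac:(lra)).
    set (r := sqrt k) in *. rewrite <- E.
    unfold cosh, sinh. auto_derive; auto. field. lra.
Qed.

Lemma is_derive_sink (k t : R) : is_derive (sink k) t (cosk k t).
Proof.
  unfold cosk, sink. destruct (total_order_T k 0) as [[H|H]|H].
  - assert (0 < sqrt (- k)) by (apply sqrt_lt_R0; lra).
    auto_derive; auto. field. lra.
  - auto_derive; auto.
  - assert (0 < sqrt k) by (apply sqrt_lt_R0; lra).
    unfold cosh, sinh. auto_derive; auto. field. lra.
Qed.

(** State [(U, P)] reached after a length [t] from the state [y], for the
    system [U' = e P], [P' = - q U] with constant [e]. *)
Definition propagate (e q t : R) (y : R * R) : R * R :=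
  (cosk (- (e * q)) t * fst y + e * sink (- (e * q)) t * snd y,
   cosk (- (e * q)) t * snd y - q * sink (- (e * q)) t * fst y).

Lemma propagate_0 (e q : R) (y : R * R) : propagate e q 0 y = y.
Proof.
  destruct y. unfold propagate; simpl. rewrite cosk_0, sink_0. f_equal; ring.
Qed.

Lemma is_derive_propagate (e q a x : R) (y : R * R) :
  is_derive (fun t => fst (propagate e q (t - a) y)) x
    (e * snd (propagate e q (x - a) y)) /\
  is_derive (fun t => snd (propagate e q (t - a) y)) x
    (- q * fst (propagate e q (x - a) y)).
Proof.
  assert (D1 := fun t => is_derive_cosk (- (e * q)) t).
  assert (D2 := fun t => is_derive_sink (- (e * q)) t).
  unfold propagate; simpl.
  set (c := cosk (- (e * q))) in *. set (s := sink (- (e * q))) in *.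
  assert (E1 : forall t, Derive c t = - (e * q) * s t)
    by (intros; apply is_derive_unique, D1).
  assert (E2 : forall t, Derive s t = c t) by (intros; apply is_derive_unique, D2).
  split; auto_derive; repeat split; try (eexists; apply D1);
    try (eexists; apply D2);
    change (fun x => c x) with c; change (fun x => s x) with s;
    rewrite ?E1, ?E2; unfold Rminus; ring.
Qed.

(** * Layered half-lines and the Wronskian *)

(** A division of the right half-line into layers: the [m]-th one is the open
    interval from [interface m] to [interface (m + 1)] and carries the
    coefficient [layer_coef m].  That the interfaces are unbounded is witnessed
    by [layer_index], which is not required to be the least such index. *)
Record layering := Layering {
  interface : nat -> R;
  layer_coef : nat -> R;
  layer_index : R -> nat;
  interface_0 : interface 0 = 0;
  interface_lt : forall m, interface m < interface (S m);
  layer_index_lt : forall x, x < interface (layer_index x)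
}.

Lemma interface_le (L : layering) (m n : nat) :
  (m <= n)%nat -> interface L m <= interface L n.
Proof.
  induction 1; [lra|]. assert (H1 := interface_lt L m0). lra.
Qed.

Lemma interface_ge0 (L : layering) (m : nat) : 0 <= interface L m.
Proof. rewrite <- (interface_0 L). apply interface_le. lia. Qed.

(** The layer to the left of [x] when [x] is an interface. *)
Lemma layer_of (L : layering) (x : R) :
  0 < x -> exists m, interface L m < x <= interface L (S m).
Proof.
  intros Hx. assert (H := layer_index_lt L x). revert H.
  induction (layer_index L x) as [|m IH]; intros H.
  - rewrite interface_0 in H. lra.
  - destruct (Rlt_dec x (interface L m)) as [H1|H1]; [auto|].
    destruct (Req_dec x (interface L m)) as [E|E].
    + destruct m; [rewrite E, interface_0 in Hx; lra|].
      exists m. assert (H2 := interface_lt L m). lra.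
    + exists m. lra.
Qed.

(** Inside each layer [eps] is the coefficient of that layer; nothing is asked
    at the interfaces. *)
Definition layered (L : layering) (eps : R -> R) : Prop :=
  forall m x, interface L m < x < interface L (S m) -> eps x = layer_coef L m.

(** The mean value theorem inside each layer, continuity across the interfaces. *)
Lemma zero_derive_layers_const (L : layering) (f : R -> R) :
  (forall x, continuous f x) ->
  (forall m x, interface L m < x < interface L (S m) -> is_derive f x 0) ->
  forall x, 0 <= x -> f x = f 0.
Proof.
  intros Hc Hd.
  assert (Hm : forall m x, interface L m <= x <= interface L (S m) ->
    f x = f (interface L m)).
  { intros m x Hx.
    destruct (MVT_gen f (interface L m) x (fun _ => 0)) as [c [_ E]].
    - rewrite Rmin_left, Rmax_right by lra. intros t Ht. apply (Hd m). lra.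
    - intros t _. apply continuity_pt_filterlim, Hc.
    - lra. }
  assert (Hi : forall m, f (interface L m) = f 0).
  { induction m; [now rewrite interface_0|].
    rewrite (Hm m); [auto|]. assert (H := interface_lt L m). lra. }
  intros x [Hx|<-]; [|reflexivity].
  destruct (layer_of L x Hx) as [m Hxm]. rewrite (Hm m), Hi; [auto|lra].
Qed.

(** [U' = e P] and [P' = - q U] inside the layers, with [U] and [P] continuous
    across the interfaces.  Only the values on the right half-line matter;
    continuity is asked on the whole line, where the functions used are
    continuous anyway. *)
Definition half_line_solution (L : layering) (q : R) (U P : R -> R) : Prop :=
  (forall x, continuous U x /\ continuous P x) /\
  forall m x, interface L m < x < interface L (S m) ->
    is_derive U x (layer_coef L m * P x) /\ is_derive P x (- q * U x).

Lemma wronskian_const (L : layering) (q : R) (U P V Q : R -> R) :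
  half_line_solution L q U P -> half_line_solution L q V Q ->
  forall x, 0 <= x -> U x * Q x - V x * P x = U 0 * Q 0 - V 0 * P 0.
Proof.
  intros [HUc HUd] [HVc HVd].
  apply (zero_derive_layers_const L (fun x => U x * Q x - V x * P x)).
  - intros x. destruct (HUc x), (HVc x).
    apply (continuous_minus (V := R_NormedModule)
      (fun x => U x * Q x) (fun x => V x * P x)).
    + apply (continuous_mult (K := R_AbsRing) U Q); auto.
    + apply (continuous_mult (K := R_AbsRing) V P); auto.
  - intros m x Hx. destruct (HUd m x Hx) as [D1 D2], (HVd m x Hx) as [D3 D4].
    apply is_derive_Reals in D1, D2, D3, D4. apply is_derive_Reals.
    replace 0 with ((layer_coef L m * P x * Q x + U x * (- q * V x)) -
      (layer_coef L m * Q x * P x + V x * (- q * U x))) by ring.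
    apply (derivable_pt_lim_minus (fun x => U x * Q x) (fun x => V x * P x));
    now apply derivable_pt_lim_mult.
Qed.

Lemma half_line_solution_minus (L : layering) (q : R) (U P V Q : R -> R) :
  half_line_solution L q U P -> half_line_solution L q V Q ->
  half_line_solution L q (fun x => U x - V x) (fun x => P x - Q x).
Proof.
  intros [HUc HUd] [HVc HVd]. split.
  - intros x. destruct (HUc x), (HVc x).
    split; apply (continuous_minus (V := R_NormedModule)); auto.
  - intros m x Hx. destruct (HUd m x Hx) as [D1 D2], (HVd m x Hx) as [D3 D4].
    split.
    + replace (layer_coef L m * (P x - Q x)) with
        (layer_coef L m * P x - layer_coef L m * Q x) by ring.
      apply (is_derive_minus (V := R_NormedModule)); auto.
    + replace (- q * (U x - V x)) with (- q * U x - - q * V x) by ring.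
      apply (is_derive_minus (V := R_NormedModule)); auto.
Qed.

(** * Existence and uniqueness in a layered medium *)

(** Solution with state [y] at [0] that is correct up to the end of the
    [m]-th layer, and continued beyond it as if that layer never ended
    (and to the left of [0] as if the first layer extended there). *)
Fixpoint layer_solution (L : layering) (q : R) (y : R * R) (m : nat) (x : R) :
    R * R :=
  match m with
  | O => propagate (layer_coef L 0) q (x - 0) y
  | S m' =>
      if Rle_dec x (interface L m) then layer_solution L q y m' x
      else propagate (layer_coef L m) q (x - interface L m)
             (layer_solution L q y m' (interface L m))
  end.

(** [Y = (U, P)] solves the system with coefficient [eps] at the point [x]; where
    [eps] is not locally constant only continuity is required. *)
Definition solves_at (q : R) (eps : R -> R) (Y : R -> R * R) (x : R) : Prop :=
  (continuous (fun t => fst (Y t)) x /\ continuous (fun t => snd (Y t)) x) /\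
  (locally_constant eps x ->
   is_derive (fun t => fst (Y t)) x (eps x * snd (Y x)) /\
   is_derive (fun t => snd (Y t)) x (- q * fst (Y x))).

Lemma solves_at_ext (q : R) (eps : R -> R) (Y Z : R -> R * R) (x : R) :
  locally x (fun t => Y t = Z t) -> solves_at q eps Y x -> solves_at q eps Z x.
Proof.
  intros HYZ [[H1 H2] H3].
  assert (E : Y x = Z x) by (apply (locally_singleton x (fun t => Y t = Z t)), HYZ).
  assert (Hf : locally x (fun t => fst (Y t) = fst (Z t)))
    by (revert HYZ; apply filter_imp; now intros t ->).
  assert (Hs : locally x (fun t => snd (Y t) = snd (Z t)))
    by (revert HYZ; apply filter_imp; now intros t ->).
  split; [split|].
  - apply (continuous_ext_loc (fun t => fst (Z t)) (fun t => fst (Y t)) x Hf H1).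
  - apply (continuous_ext_loc (fun t => snd (Z t)) (fun t => snd (Y t)) x Hs H2).
  - intros Hc. destruct (H3 Hc) as [H4 H5]. rewrite <- E. split.
    + apply (is_derive_ext_loc (fun t => fst (Y t)) _ x _ Hf H4).
    + apply (is_derive_ext_loc (fun t => snd (Y t)) _ x _ Hs H5).
Qed.

Lemma propagate_solves_at (e q a x : R) (y : R * R) :
  solves_at q (fun _ => e) (fun t => propagate e q (t - a) y) x.
Proof.
  destruct (is_derive_propagate e q a x y) as [D1 D2]. split; [split|]; auto.
  - eapply is_derive_continuous; apply D1.
  - eapply is_derive_continuous; apply D2.
Qed.

(** If [eps] is locally constant at [x], the two pieces glued there have the
    same coefficient, so that the derivatives agree; otherwise only continuity
    has to be checked. *)
Lemma solves_at_glue (q e e' : R) (eps : R -> R) (X Y Z : R -> R * R) (x : R) :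
  solves_at q (fun _ => e) Y x -> solves_at q (fun _ => e') Z x ->
  X x = Y x -> X x = Z x -> (forall t, X t = Y t \/ X t = Z t) ->
  (locally_constant eps x -> eps x = e /\ eps x = e') ->
  solves_at q eps X x.
Proof.
  intros [[Y1 Y2] Y3] [[Z1 Z2] Z3] EY EZ Hl He.
  destruct (Y3 (locally_constant_const e x)) as [Y4 Y5].
  destruct (Z3 (locally_constant_const e' x)) as [Z4 Z5].
  assert (Hl1 : locally x (fun t => fst (X t) = fst (Y t) \/ fst (X t) = fst (Z t)))
    by (apply filter_forall; intros t; destruct (Hl t) as [->| ->]; auto).
  assert (Hl2 : locally x (fun t => snd (X t) = snd (Y t) \/ snd (X t) = snd (Z t)))
    by (apply filter_forall; intros t; destruct (Hl t) as [->| ->]; auto).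
  split; [split|].
  - eapply continuous_glue; [exact Y1|exact Z1| | |exact Hl1]; simpl; congruence.
  - eapply continuous_glue; [exact Y2|exact Z2| | |exact Hl2]; simpl; congruence.
  - intros Hc. destruct (He Hc) as [E1 E2].
    rewrite <- EY, <- E1 in Y4. rewrite <- EZ, <- E2 in Z4.
    rewrite <- EY in Y5. rewrite <- EZ in Z5. split.
    + eapply is_derive_glue; [exact Y4|exact Z4| | |exact Hl1]; simpl; congruence.
    + eapply is_derive_glue; [exact Y5|exact Z5| | |exact Hl2]; simpl; congruence.
Qed.

Lemma layer_solution_le (L : layering) (q : R) (y : R * R) (m : nat) (x : R) :
  x <= interface L (S m) ->
  layer_solution L q y (S m) x = layer_solution L q y m x.
Proof. intros H. simpl. destruct Rle_dec; [reflexivity|contradiction]. Qed.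

Lemma layer_solution_gt (L : layering) (q : R) (y : R * R) (m : nat) (x : R) :
  interface L (S m) <= x ->
  layer_solution L q y (S m) x =
  propagate (layer_coef L (S m)) q (x - interface L (S m))
    (layer_solution L q y (S m) (interface L (S m))).
Proof.
  intros H.
  rewrite (layer_solution_le _ _ _ _ (interface L (S m))) by lra.
  simpl. destruct Rle_dec; [|reflexivity].
  replace x with (interface L (S m)) by lra. now rewrite Rminus_diag, propagate_0.
Qed.

Lemma solves_at_not_constant (q e : R) (eps : R -> R) (Y : R -> R * R) (x : R) :
  solves_at q (fun _ => e) Y x -> (locally_constant eps x -> eps x = e) ->
  solves_at q eps Y x.
Proof.
  intros [H1 H2] He. split; auto. intros Hc. rewrite He by auto.
  apply H2, locally_constant_const.
Qed.

(** The second conclusion, that the last layer is continued indefinitely, is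
    what allows the next layer to be glued at its left end. *)
Lemma layer_solution_solves (L : layering) (q : R) (eps : R -> R) (y : R * R)
    (m : nat) :
  layered L eps ->
  (forall x, 0 < x <= interface L m ->
     solves_at q eps (layer_solution L q y m) x) /\
  (forall x, interface L m < x ->
     solves_at q (fun _ => layer_coef L m) (layer_solution L q y m) x).
Proof.
  intros HL. induction m as [|m [IH1 IH2]].
  - split; intros x Hx; [rewrite interface_0 in Hx; lra|].
    simpl. apply propagate_solves_at.
  - assert (Hm := interface_lt L m). assert (HSm := interface_lt L (S m)).
    assert (Hnext : forall x, interface L (S m) < x ->
       solves_at q (fun _ => layer_coef L (S m)) (layer_solution L q y (S m)) x).
    { intros x Hx. eapply solves_at_ext; [|apply propagate_solves_at].
      apply (locally_between (interface L (S m)) (x + 1)); [lra|].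
      intros t Ht. symmetry. apply layer_solution_gt. lra. }
    split; [|exact Hnext].
    intros x Hx. destruct (proj2 Hx) as [Hlt|E].
    + apply (solves_at_ext _ _ (layer_solution L q y m)).
      * apply (locally_between 0 (interface L (S m))); [lra|].
        intros t Ht. symmetry. apply layer_solution_le. lra.
      * destruct (Rle_dec x (interface L m)); [apply IH1; lra|].
        eapply solves_at_not_constant; [apply IH2; lra|].
        intros _. apply HL. lra.
    + apply (solves_at_glue q (layer_coef L m) (layer_coef L (S m)) eps _
        (layer_solution L q y m)
        (fun t => propagate (layer_coef L (S m)) q (t - interface L (S m))
          (layer_solution L q y (S m) (interface L (S m))))).
      * apply IH2. lra.
      * apply propagate_solves_at.
      * apply layer_solution_le. lra.
      * apply layer_solution_gt. lra.
      * intros t. destruct (Rle_dec t (interface L (S m))).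
        -- left. now apply layer_solution_le.
        -- right. apply layer_solution_gt. lra.
      * intros Hc. split.
        -- apply (locally_constant_left eps x (interface L m)); auto; [lra|].
           intros; apply HL; lra.
        -- apply (locally_constant_right eps x (interface L (S (S m)))); auto;
           [lra|]. intros; apply HL; lra.
Qed.

(** The solution on the right half-line with state [y] at [0]. *)
Definition half_line_ivp (L : layering) (q : R) (y : R * R) (x : R) : R * R :=
  layer_solution L q y (layer_index L x) x.

Lemma layer_solution_stable (L : layering) (q : R) (y : R * R) (m n : nat)
    (x : R) :
  (m <= n)%nat -> x < interface L m ->
  layer_solution L q y n x = layer_solution L q y m x.
Proof.
  induction 1 as [|n Hmn IH]; intros Hx; [reflexivity|].
  rewrite <- IH by auto. apply layer_solution_le.
  assert (H := interface_le L m (S n) ltac:(lia)). lra.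
Qed.

Lemma half_line_ivp_eq (L : layering) (q : R) (y : R * R) (m : nat) (x : R) :
  x < interface L m -> half_line_ivp L q y x = layer_solution L q y m x.
Proof.
  intros Hx. unfold half_line_ivp.
  assert (Hi := layer_index_lt L x).
  destruct (Nat.le_ge_cases m (layer_index L x)).
  - now apply layer_solution_stable.
  - symmetry. now apply layer_solution_stable.
Qed.

(** The image of the state function [(U, P)] under [x |-> - x], which reverses
    the sign of the flux. *)
Definition reflect (Y : R -> R * R) (x : R) : R * R :=
  (fst (Y (- x)), - snd (Y (- x))).

(** The solution on the whole line with state [y] at [0], for an even
    coefficient: on the left it is the reflection of the solution with the
    reflected state. *)
Definition line_solution (L : layering) (q : R) (y : R * R) (x : R) : R * R :=
  if Rle_dec 0 x then half_line_ivp L q y x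
  else reflect (half_line_ivp L q (fst y, - snd y)) x.

Lemma solves_at_reflect (q : R) (eps : R -> R) (Y : R -> R * R) (x : R) :
  (forall t, eps (- t) = eps t) ->
  solves_at q eps Y (- x) -> solves_at q eps (reflect Y) x.
Proof.
  intros He [[H1 H2] H3]. unfold reflect. split; [split|]; simpl.
  - apply (continuous_reflect (fun t => fst (Y t))), H1.
  - apply (continuous_opp (V := R_NormedModule)).
    apply (continuous_reflect (fun t => snd (Y t))), H2.
  - intros Hc. destruct H3 as [D1 D2].
    { assert (Hc' : locally (- x) (fun t => eps (- t) = eps x))
        by (apply (locally_opp (- x) (fun t => eps t = eps x));
            rewrite Ropp_involutive; exact Hc).
      unfold locally_constant. revert Hc'. apply filter_imp.
      intros t. now rewrite !He. }
    rewrite He in D1. split.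
    + replace (eps x * - snd (Y (- x))) with (- (eps x * snd (Y (- x)))) by ring.
      apply (is_derive_reflect (fun t => fst (Y t))), D1.
    + apply (is_derive_reflect (fun t => snd (Y t))) in D2.
      apply (is_derive_opp (V := R_NormedModule)) in D2.
      rewrite Ropp_involutive in D2.
      exact D2.
Qed.

Lemma line_solution_0 (L : layering) (q : R) (y : R * R) :
  line_solution L q y 0 = y.
Proof.
  unfold line_solution. destruct Rle_dec; [|lra].
  rewrite (half_line_ivp_eq L q y 1).
  - rewrite layer_solution_le by (apply interface_ge0).
    simpl. now rewrite Rminus_diag, propagate_0.
  - rewrite <- (interface_0 L). apply interface_lt.
Qed.

Lemma half_line_ivp_solves (L : layering) (q : R) (eps : R -> R)
    (y : R * R) (x : R) :
  layered L eps -> 0 < x -> solves_at q eps (half_line_ivp L q y) x.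
Proof.
  intros HL Hx. assert (Hi := layer_index_lt L x).
  apply (solves_at_ext _ _ (layer_solution L q y (layer_index L x))).
  - apply (locally_between 0 (interface L (layer_index L x))); [lra|].
    intros t Ht. symmetry. now apply half_line_ivp_eq.
  - apply layer_solution_solves; [exact HL|lra].
Qed.

Lemma line_solution_solves (L : layering) (q : R) (eps : R -> R) (y : R * R)
    (x : R) :
  layered L eps -> (forall t, eps (- t) = eps t) ->
  solves_at q eps (line_solution L q y) x.
Proof.
  intros HL He.
  set (y' := (fst y, - snd y)).
  destruct (total_order_T x 0) as [[Hx|Hx]|Hx].
  - apply (solves_at_ext _ _ (reflect (half_line_ivp L q y'))).
    + apply (locally_between (x - 1) 0); [lra|]. intros t Ht.
      unfold line_solution. destruct Rle_dec; [lra|reflexivity].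
    + apply solves_at_reflect; [exact He|].
      apply half_line_ivp_solves; [exact HL|lra].
  - subst x.
    assert (Hb := interface_lt L 0). rewrite interface_0 in Hb.
    set (e := layer_coef L 0).
    apply (solves_at_ext _ _ (fun t =>
      if Rle_dec 0 t then propagate e q (t - 0) y
      else reflect (fun t => propagate e q (t - 0) y') t)).
    + apply (locally_between (- interface L 1) (interface L 1)); [lra|].
      intros t Ht. unfold line_solution, reflect.
      rewrite !(half_line_ivp_eq L q _ 1) by lra.
      rewrite !layer_solution_le by lra. reflexivity.
    + apply (solves_at_glue q e e _ _ (fun t => propagate e q (t - 0) y)
        (reflect (fun t => propagate e q (t - 0) y'))).
      * apply propagate_solves_at.
      * apply solves_at_reflect; [auto|]. apply propagate_solves_at.
      * destruct Rle_dec; [reflexivity|lra].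
      * destruct Rle_dec; [|lra]. unfold reflect.
        rewrite Ropp_0, Rminus_diag, !propagate_0.
        destruct y. simpl. now rewrite Ropp_involutive.
      * intros t. destruct Rle_dec; auto.
      * intros Hc. assert (eps 0 = e); [|auto].
        apply (locally_constant_right eps 0 (interface L 1)); auto.
        intros t Ht. apply HL. rewrite interface_0. exact Ht.
  - apply (solves_at_ext _ _ (half_line_ivp L q y)).
    + apply (locally_between 0 (x + 1)); [lra|]. intros t Ht.
      unfold line_solution. destruct Rle_dec; [reflexivity|lra].
    + now apply half_line_ivp_solves.
Qed.

Lemma layered_locally_constant (L : layering) (eps : R -> R) (m : nat) (x : R) :
  layered L eps -> interface L m < x < interface L (S m) ->
  locally_constant eps x.
Proof.
  intros HL Hx. apply (locally_between _ _ _ _ Hx).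
  intros t Ht. now rewrite (HL m t), (HL m x).
Qed.

Lemma solves_half_line (L : layering) (q : R) (eps : R -> R) (Y : R -> R * R) :
  layered L eps -> (forall x, solves_at q eps Y x) ->
  half_line_solution L q (fun x => fst (Y x)) (fun x => snd (Y x)).
Proof.
  intros HL HY. split; [apply HY|].
  intros m x Hx. rewrite <- (HL m x Hx).
  apply HY. now apply (layered_locally_constant L _ m).
Qed.

(** The difference of the two solutions has zero Wronskian with both
    fundamental solutions, whose own Wronskian is [1]. *)
Lemma half_line_unique (L : layering) (q : R) (eps : R -> R)
    (U P V Q : R -> R) :
  layered L eps -> (forall t, eps (- t) = eps t) ->
  half_line_solution L q U P -> half_line_solution L q V Q ->
  U 0 = V 0 -> P 0 = Q 0 ->
  forall x, 0 <= x -> U x = V x /\ P x = Q x.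
Proof.
  intros HL He HU HV E1 E2 x Hx.
  assert (HD := half_line_solution_minus L q U P V Q HU HV).
  assert (HC := solves_half_line L q eps _ HL
    (fun t => line_solution_solves L q eps (1, 0) t HL He)).
  assert (HS := solves_half_line L q eps _ HL
    (fun t => line_solution_solves L q eps (0, 1) t HL He)).
  assert (W1 := wronskian_const _ _ _ _ _ _ HD HC x Hx).
  assert (W2 := wronskian_const _ _ _ _ _ _ HD HS x Hx).
  assert (W3 := wronskian_const _ _ _ _ _ _ HC HS x Hx).
  simpl in *. rewrite !line_solution_0 in *. simpl in *.
  rewrite E1, E2 in *.
  set (c := fst (line_solution L q (1, 0) x)) in *.
  set (s := fst (line_solution L q (0, 1) x)) in *.
  set (c' := snd (line_solution L q (1, 0) x)) in *.
  set (s' := snd (line_solution L q (0, 1) x)) in *.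
  set (d := U x - V x) in *. set (d' := P x - Q x) in *.
  assert (d = 0).
  { replace d with (d * (c * s' - s * c')) by (rewrite W3; ring).
    replace (d * (c * s' - s * c')) with
      (c * (d * s' - s * d') - s * (d * c' - c * d')) by ring.
    rewrite W1, W2. ring. }
  assert (d' = 0).
  { replace d' with (d' * (c * s' - s * c')) by (rewrite W3; ring).
    replace (d' * (c * s' - s * c')) with
      (c' * (d * s' - s * d') - s' * (d * c' - c * d')) by ring.
    rewrite W1, W2. ring. }
  unfold d, d' in *. lra.
Qed.

(** At an interface, continuity forces the coefficients of the two adjacent
    layers to be equal. *)
Lemma layered_even_locally_constant (L : layering) (eps : R -> R) (x : R) :
  layered L eps -> (forall t, eps (- t) = eps t) ->
  continuous eps x -> locally_constant eps x.
Proof.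
  intros HL He.
  assert (Hpos : forall x, 0 < x -> continuous eps x -> locally_constant eps x).
  { clear x. intros x Hx Hc. destruct (layer_of L x Hx) as [m [Hm [Hlt|E]]].
    - now apply (layered_locally_constant L _ m).
    - assert (HS := interface_lt L (S m)).
      assert (E1 : eps x = layer_coef L m).
      { apply (continuous_left_value eps x (interface L m)); auto.
        intros t Ht. apply HL. lra. }
      assert (E2 : eps x = layer_coef L (S m)).
      { apply (continuous_right_value eps x (interface L (S (S m)))); auto; [lra|].
        intros t Ht. apply HL. lra. }
      apply (locally_between (interface L m) (interface L (S (S m)))); [lra|].
      intros t Ht. destruct (total_order_T t x) as [[H|H]|H].
      + rewrite E1. apply HL. lra.
      + now subst.
      + rewrite E2. apply HL. lra. }
  intros Hc. destruct (total_order_T x 0) as [[H|H]|H].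
  - assert (H' : locally_constant eps (- x)).
    { apply Hpos; [lra|].
      apply (continuous_ext (fun t => eps (- t))); [exact He|].
      apply continuous_reflect. now rewrite Ropp_involutive. }
    apply (locally_opp x (fun t => eps t = eps (- x))) in H'.
    unfold locally_constant. revert H'. apply filter_imp.
    intros t. now rewrite !He.
  - subst. assert (Hb := interface_lt L 0). rewrite interface_0 in Hb.
    assert (E1 : eps 0 = layer_coef L 0).
    { apply (continuous_right_value eps 0 (interface L 1)); auto.
      intros t Ht. apply HL. rewrite interface_0. exact Ht. }
    apply (locally_between (- interface L 1) (interface L 1)); [lra|].
    intros t Ht. rewrite E1. destruct (total_order_T t 0) as [[H|H]|H].
    + rewrite <- He. apply HL. rewrite interface_0. lra.
    + now subst.
    + apply HL. rewrite interface_0. lra.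
  - now apply Hpos.
Qed.

Lemma layered_even_value (L : layering) (eps : R -> R) (x : R) :
  layered L eps -> (forall t, eps (- t) = eps t) ->
  locally_constant eps x -> exists m, eps x = layer_coef L m.
Proof.
  intros HL He Hc.
  assert (Habs : eps x = eps (Rabs x))
    by (unfold Rabs; destruct Rcase_abs; auto).
  destruct (Req_dec (Rabs x) 0) as [E|E].
  - exists 0%nat. rewrite Habs, E. apply Rabs_eq_0 in E. subst.
    assert (Hb := interface_lt L 0). rewrite interface_0 in Hb.
    apply (locally_constant_right eps 0 (interface L 1)); auto.
    intros t Ht. apply HL. rewrite interface_0. exact Ht.
  - assert (Hx := Rabs_pos x).
    destruct (layer_of L (Rabs x) ltac:(lra)) as [m Hm]. exists m. rewrite Habs.
    apply (locally_constant_left eps (Rabs x) (interface L m)); [lra| |].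
    + intros t Ht. apply HL. lra.
    + unfold Rabs in *. destruct Rcase_abs; [|exact Hc].
      assert (Hc' : locally (- x) (fun t => eps (- t) = eps x))
        by (apply (locally_opp (- x) (fun t => eps t = eps x));
            rewrite Ropp_involutive; exact Hc).
      unfold locally_constant. revert Hc'. apply filter_imp.
      intros t. now rewrite !He.
Qed.

(** * Periodic symmetric materials as layered media *)

(** The number of layers in a unit cell. *)
Definition cell_size (g : geometry) : nat := (2 * inclusions g + 1)%nat.

(** Interface number [n * cell_size g + i] is node [i] of the [n]-th cell. *)
Definition cell_interface (g : geometry) (m : nat) : R :=
  INR (m / cell_size g) + node g (m mod cell_size g).

Lemma cell_interface_eq (g : geometry) (n i : nat) :
  (i <= cell_size g)%nat ->
  cell_interface g (n * cell_size g + i) = INR n + node g i.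
Proof.
  intros Hi. assert (HK : cell_size g <> 0%nat) by (unfold cell_size; lia).
  unfold cell_interface. destruct (Nat.eq_dec i (cell_size g)) as [->|Hne].
  - replace (n * cell_size g + cell_size g)%nat with (S n * cell_size g)%nat by lia.
    rewrite Nat.div_mul, Nat.Div0.mod_mul by exact HK.
    unfold cell_size. rewrite node_first, node_last, S_INR. lra.
  - rewrite Nat.add_comm, Nat.div_add, Nat.Div0.mod_add by exact HK.
    now rewrite Nat.div_small, Nat.mod_small by lia.
Qed.

Lemma cell_interface_div (g : geometry) (m : nat) :
  exists n i, m = (n * cell_size g + i)%nat /\ (i < cell_size g)%nat.
Proof.
  assert (HK : cell_size g <> 0%nat) by (unfold cell_size; lia).
  exists (m / cell_size g)%nat, (m mod cell_size g)%nat. split.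
  - rewrite Nat.mul_comm. now apply Nat.div_mod.
  - now apply Nat.mod_upper_bound.
Qed.

Lemma cell_interface_0 (g : geometry) : cell_interface g 0 = 0.
Proof.
  change 0%nat with (0 * cell_size g + 0)%nat at 1.
  rewrite cell_interface_eq by lia. rewrite node_first. simpl. lra.
Qed.

Lemma cell_interface_lt (g : geometry) (m : nat) :
  cell_interface g m < cell_interface g (S m).
Proof.
  destruct (cell_interface_div g m) as [n [i [-> Hi]]].
  replace (S (n * cell_size g + i)) with (n * cell_size g + S i)%nat by lia.
  rewrite !cell_interface_eq by lia.
  assert (H := node_lt g i Hi). lra.
Qed.

Definition cell_index (g : geometry) (x : R) : nat :=
  (Z.to_nat (up x) * cell_size g + 0)%nat.

Lemma cell_index_lt (g : geometry) (x : R) :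
  x < cell_interface g (cell_index g x).
Proof.
  unfold cell_index. rewrite cell_interface_eq by lia. rewrite node_first.
  destruct (archimed x) as [H _].
  assert (IZR (up x) <= INR (Z.to_nat (up x))); [|lra].
  rewrite INR_IZR_INZ. apply IZR_le. lia.
Qed.

Definition material_layering (g : geometry) (e1 e2 : R) : layering :=
  Layering (cell_interface g)
    (fun m => if Nat.even (m mod cell_size g) then e1 else e2)
    (cell_index g) (cell_interface_0 g) (cell_interface_lt g) (cell_index_lt g).

Lemma periodic_nat (f : R -> R) :
  (forall x, f (x + 1) = f x) -> forall (n : nat) x, f (INR n + x) = f x.
Proof.
  intros Hf n. induction n as [|n IH]; intros x.
  - now rewrite Rplus_0_l.
  - rewrite S_INR, <- (IH x), <- (Hf (INR n + x)). f_equal. ring.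
Qed.

Lemma periodic_Z (f : R -> R) :
  (forall x, f (x + 1) = f x) -> forall (n : Z) x, f (IZR n + x) = f x.
Proof.
  intros Hf n x. destruct (Z_le_gt_dec 0 n) as [Hn|Hn].
  - rewrite <- (Z2Nat.id n Hn), <- INR_IZR_INZ. now apply periodic_nat.
  - rewrite <- (periodic_nat f Hf (Z.to_nat (- n)) (IZR n + x)).
    f_equal. rewrite INR_IZR_INZ, Z2Nat.id, opp_IZR by lia. ring.
Qed.

Lemma material_layered (g : geometry) (eps1 eps2 : R -> R) (eps : R -> R -> R)
    (omega : R) :
  material_permittivity g eps1 eps2 eps ->
  layered (material_layering g (eps1 omega) (eps2 omega)) (fun x => eps x omega).
Proof.
  intros [Hper H1 H2 _] m x. simpl.
  destruct (cell_interface_div g m) as [n [i [-> Hi]]].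
  replace (S (n * cell_size g + i)) with (n * cell_size g + S i)%nat by lia.
  rewrite !cell_interface_eq by lia. intros Hx.
  rewrite Nat.add_comm, Nat.Div0.mod_add, Nat.mod_small by exact Hi.
  replace x with (INR n + (x - INR n)) by ring.
  rewrite (periodic_nat (fun x => eps x omega)) by auto.
  unfold cell_size in Hi.
  destruct (Nat.even i) eqn:Ei.
  - apply Nat.even_spec in Ei. destruct Ei as [j ->].
    apply H1. exists j. split; [lia|].
    replace (2 * j + 1)%nat with (S (2 * j)) by lia. lra.
  - assert (Oi : Nat.odd i = true) by now rewrite <- Nat.negb_even, Ei.
    apply Nat.odd_spec in Oi. destruct Oi as [j ->].
    apply H2. exists j. split; [lia|].
    replace (2 * j + 2)%nat with (S (2 * j + 1)) by lia. lra.
Qed.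

(** Mirror symmetry about [1/2] together with period [1]. *)
Lemma material_even (g : geometry) (eps1 eps2 : R -> R) (eps : R -> R -> R)
    (omega x : R) :
  material_permittivity g eps1 eps2 eps -> eps (- x) omega = eps x omega.
Proof.
  intros [Hper _ _ Hmir].
  assert (P := periodic_Z (fun x => eps x omega) (fun x => Hper x omega)).
  simpl in P. destruct (archimed x) as [A1 A2].
  (* [k] is the integer part of [x]. *)
  set (k := (up x - 1)%Z). set (y := x - IZR k).
  assert (Ek : IZR k = IZR (up x) - 1) by (unfold k; now rewrite minus_IZR).
  assert (Hy : 0 <= y <= 1) by (unfold y; lra).
  replace (- x) with (IZR (- k) + - y) by (unfold y; rewrite opp_IZR; ring).
  replace x with (IZR k + y) by (unfold y; ring).
  rewrite !P, <- Hper, (Hmir y) by exact Hy. f_equal. ring.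
Qed.

Lemma material_near_0 (g : geometry) (eps1 eps2 : R -> R) (eps : R -> R -> R)
    (omega x : R) :
  material_permittivity g eps1 eps2 eps -> Rabs x <= node g 1 ->
  eps x omega = eps1 omega.
Proof.
  intros Hm Hx.
  assert (H : forall t, 0 <= t <= node g 1 -> eps t omega = eps1 omega).
  { intros t Ht. apply (permittivity_D1 _ _ _ _ Hm). exists 0%nat.
    split; [lia|]. simpl. now rewrite node_first. }
  assert (Rabs_pos := Rabs_pos x).
  unfold Rabs in *. destruct Rcase_abs.
  - rewrite <- (material_even _ _ _ _ omega x Hm). apply H. lra.
  - apply H. lra.
Qed.

Lemma node_1_pos (g : geometry) : 0 < node g 1.
Proof.
  rewrite <- (node_first g). apply node_lt. lia.
Qed.

Lemma material_near_integer (g : geometry) (eps1 eps2 : R -> R)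
    (eps : R -> R -> R) (omega : R) (n : Z) :
  material_permittivity g eps1 eps2 eps ->
  locally (IZR n) (fun t => eps t omega = eps1 omega).
Proof.
  intros Hm. assert (H1 := node_1_pos g).
  apply (locally_between (IZR n - node g 1) (IZR n + node g 1)); [lra|].
  intros t Ht. replace t with (IZR n + (t - IZR n)) by ring.
  rewrite (periodic_Z (fun x => eps x omega)) by (intros; apply Hm).
  apply (material_near_0 g eps1 eps2); [exact Hm|].
  apply Rabs_le. lra.
Qed.

(** * The Helmholtz equation as a first-order system *)

(** The complex-valued function whose real and imaginary parts are the first
    components of two state functions. *)
Definition complex_solution (Y Z : R -> R * R) (x : R) : C :=
  (fst (Y x), fst (Z x)).

Lemma complex_solution_CDerive (q : R) (eps : R -> R) (Y Z : R -> R * R) (x : R) :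
  solves_at q eps Y x -> solves_at q eps Z x -> locally_constant eps x ->
  CDerive (complex_solution Y Z) x = (eps x * snd (Y x), eps x * snd (Z x)).
Proof.
  intros [_ HY] [_ HZ] Hc. apply is_derive_CDerive; [apply HY|apply HZ]; exact Hc.
Qed.

Lemma complex_solution_flux (q : R) (eps : R -> R) (Y Z : R -> R * R) (x : R) :
  solves_at q eps Y x -> solves_at q eps Z x -> locally_constant eps x ->
  eps x <> 0 ->
  flux eps (complex_solution Y Z) x = (snd (Y x), snd (Z x)).
Proof.
  intros HY HZ Hc H0. unfold flux.
  rewrite (complex_solution_CDerive q eps Y Z x HY HZ Hc).
  unfold RtoC, Cmult; simpl. f_equal; field; exact H0.
Qed.

Lemma helmholtz_complex_solution (mu0 omega : R) (eps : R -> R)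
    (Y Z : R -> R * R) :
  mu0 <> 0 -> (forall x, locally_constant eps x -> eps x <> 0) ->
  (forall x, continuous eps x -> locally_constant eps x) ->
  (forall x, solves_at (mu0 * omega ^ 2) eps Y x) ->
  (forall x, solves_at (mu0 * omega ^ 2) eps Z x) ->
  helmholtz_solution mu0 eps omega (complex_solution Y Z).
Proof.
  intros Hmu H0 Hlc HY HZ. split; [|split].
  - intros x. apply continuous_complex; [apply HY|apply HZ].
  - exists (fun x => (snd (Y x), snd (Z x))). split.
    + intros x. apply continuous_complex; [apply HY|apply HZ].
    + intros x Hx. apply (complex_solution_flux (mu0 * omega ^ 2)); auto.
  - intros x Hx. specialize (Hlc x Hx).
    destruct (proj2 (HY x) Hlc) as [Y1 Y2]. destruct (proj2 (HZ x) Hlc) as [Z1 Z2].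
    assert (Hloc : locally x (fun t =>
       (snd (Y t), snd (Z t)) = flux eps (complex_solution Y Z) t)).
    { generalize (locally_locally_constant eps x Hlc). apply filter_imp.
      intros t Ht. symmetry.
      apply (complex_solution_flux (mu0 * omega ^ 2)); auto. }
    assert (HD := is_derive_ext_loc (V := C_R_NormedModule) _ _ x _ Hloc
      (is_derive_complex _ _ _ _ _ Y2 Z2)).
    repeat split.
    + eexists. apply (is_derive_complex _ _ _ _ _ Y1 Z1).
    + eexists. apply HD.
    + unfold helmholtz_op.
      rewrite (is_derive_CDerive _ _ _ _ (is_derive_Re _ _ _ HD)
        (is_derive_Im _ _ _ HD)).
      unfold complex_solution, RtoC, Cmult; simpl. f_equal; field; exact Hmu.
Qed.

(** [u' = eps w] and [w' = - q u] at [x], the derivatives being taken on real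
    and imaginary parts. *)
Definition first_order_at (q : R) (eps : R -> R) (u w : R -> C) (x : R) : Prop :=
  CDerive u x = (RtoC (eps x) * w x)%C /\
  (is_derive (fun t => Re (u t)) x (eps x * Re (w x)) /\
   is_derive (fun t => Re (w t)) x (- q * Re (u x))) /\
  (is_derive (fun t => Im (u t)) x (eps x * Im (w x)) /\
   is_derive (fun t => Im (w t)) x (- q * Im (u x))).

Lemma helmholtz_first_order (mu0 omega : R) (eps : R -> R) (u w : R -> C) (x : R) :
  mu0 <> 0 -> eps x <> 0 -> locally_constant eps x ->
  (forall t, continuous eps t -> flux eps u t = w t) ->
  @ex_derive R_AbsRing C_R_NormedModule u x ->
  @ex_derive R_AbsRing C_R_NormedModule (flux eps u) x ->
  helmholtz_op mu0 eps u x = (RtoC (omega ^ 2) * u x)%C ->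
  first_order_at (mu0 * omega ^ 2) eps u w x.
Proof.
  intros Hmu H0 Hlc Hw Hu Hf Heq.
  assert (Eu : CDerive u x = (RtoC (eps x) * w x)%C).
  { rewrite <- Hw by now apply locally_constant_continuous.
    unfold flux. rewrite Cmult_assoc, <- RtoC_mult, Rinv_r by exact H0.
    now rewrite Cmult_1_l. }
  destruct (ex_derive_CDerive _ _ Hu) as [U1 U2].
  destruct (ex_derive_CDerive _ _ Hf) as [F1 F2].
  assert (Ef : CDerive (flux eps u) x = (RtoC (- (mu0 * omega ^ 2)) * u x)%C).
  { replace (RtoC (- (mu0 * omega ^ 2)) * u x)%C with
      (RtoC (- mu0) * (RtoC (omega ^ 2) * u x))%C
      by (rewrite Cmult_assoc, <- RtoC_mult; do 2 f_equal; ring).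
    rewrite <- Heq. unfold helmholtz_op.
    rewrite Cmult_assoc, <- RtoC_mult.
    replace (- mu0 * - / mu0) with 1 by (field; exact Hmu).
    now rewrite Cmult_1_l. }
  assert (Hloc : locally x (fun t => flux eps u t = w t)).
  { generalize (locally_locally_constant eps x Hlc). apply filter_imp.
    intros t Ht. apply Hw. now apply locally_constant_continuous. }
  rewrite Eu in U1, U2. rewrite Ef in F1, F2.
  split; [exact Eu|]. split; split.
  - replace (eps x * Re (w x)) with (Re (RtoC (eps x) * w x)%C)
      by (unfold RtoC, Cmult, Re; simpl; ring). exact U1.
  - replace (- (mu0 * omega ^ 2) * Re (u x)) with
      (Re (RtoC (- (mu0 * omega ^ 2)) * u x)%C)
      by (unfold RtoC, Cmult, Re; simpl; ring).
    apply (is_derive_ext_loc (fun t => Re (flux eps u t))); [|exact F1].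
    revert Hloc. apply filter_imp. now intros t ->.
  - replace (eps x * Im (w x)) with (Im (RtoC (eps x) * w x)%C)
      by (unfold RtoC, Cmult, Im; simpl; ring). exact U2.
  - replace (- (mu0 * omega ^ 2) * Im (u x)) with
      (Im (RtoC (- (mu0 * omega ^ 2)) * u x)%C)
      by (unfold RtoC, Cmult, Im; simpl; ring).
    apply (is_derive_ext_loc (fun t => Im (flux eps u t))); [|exact F2].
    revert Hloc. apply filter_imp. now intros t ->.
Qed.

(** * The transfer matrix *)

(** The matrix with rows [(a, b)] and [(c, d)]. *)
Definition matrix2 (a b c d : C) : @matrix C 2 2 :=
  mk_matrix 2 2 (fun i j =>
    match i, j with
    | O, O => a | O, _ => b | _, O => c | _, _ => d
    end).

Definition vector2 (x y : C) : @matrix C 2 1 :=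
  mk_matrix 2 1 (fun i _ => match i with O => x | _ => y end).

Lemma matrix2_surj (T : @matrix C 2 2) : exists a b c d, T = matrix2 a b c d.
Proof.
  destruct T as [[a [b []]] [[c [d []]] []]]. now exists a, b, c, d.
Qed.

Lemma vector2_surj (v : @matrix C 2 1) : exists x y, v = vector2 x y.
Proof.
  destruct v as [[x []] [[y []] []]]. now exists x, y.
Qed.

Lemma vector2_inj (x y x' y' : C) :
  vector2 x y = vector2 x' y' -> x = x' /\ y = y'.
Proof. intros H. now inversion H. Qed.

Lemma Mmult_vector2 (a b c d x y : C) :
  Mmult (matrix2 a b c d) (vector2 x y) =
  vector2 (a * x + b * y)%C (c * x + d * y)%C.
Proof.
  unfold Mmult, vector2 at 2. apply mk_matrix_ext. intros i j Hi Hj.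
  change (pred 2) with 1%nat. rewrite sum_Sn, sum_O.
  destruct j as [|j]; [|lia].
  destruct i as [|[|i]]; [reflexivity|reflexivity|lia].
Qed.

(** What is needed of a material at a fixed frequency: it is even, layered on
    the right half-line, with non-zero coefficients, and equal to [e0] around
    the integers, the end points of the cells. *)
Record symmetric_medium (L : layering) (e0 : R) (eps : R -> R) : Prop := {
  medium_layered : layered L eps;
  medium_even : forall t, eps (- t) = eps t;
  medium_coef : forall m, layer_coef L m <> 0;
  medium_integer : forall n : Z, locally (IZR n) (fun t => eps t = e0)
}.

Lemma material_symmetric_medium (g : geometry) (eps1 eps2 : R -> R)
    (eps : R -> R -> R) (omega : R) :
  eps1 omega <> 0 -> eps2 omega <> 0 ->
  material_permittivity g eps1 eps2 eps ->
  symmetric_medium (material_layering g (eps1 omega) (eps2 omega)) (eps1 omega)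
    (fun x => eps x omega).
Proof.
  intros H1 H2 Hm. split.
  - now apply material_layered.
  - intros t. now apply (material_even g eps1 eps2).
  - intros m. simpl. now destruct Nat.even.
  - intros n. now apply (material_near_integer g eps1 eps2).
Qed.

Lemma medium_neq0 (L : layering) (e0 : R) (eps : R -> R) (x : R) :
  symmetric_medium L e0 eps -> locally_constant eps x -> eps x <> 0.
Proof.
  intros [HL He Hc _] Hx.
  destruct (layered_even_value L eps x HL He Hx) as [m ->]. apply Hc.
Qed.

Lemma medium_e0_neq0 (L : layering) (e0 : R) (eps : R -> R) :
  symmetric_medium L e0 eps -> e0 <> 0.
Proof.
  intros H.
  destruct (locally_value_constant eps (IZR 0) e0 (medium_integer _ _ _ H 0%Z))
    as [E Hc].
  rewrite <- E. now apply (medium_neq0 L e0).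
Qed.

(** The flux of [complex_solution Y Z]. *)
Definition complex_flux (Y Z : R -> R * R) (x : R) : C := (snd (Y x), snd (Z x)).

(** At the integers [u' = e0 w], so the transfer matrix acts on the vector
    [(u, e0 w)]. *)
Lemma transfer_complex_solution (L : layering) (mu0 omega e0 : R) (eps : R -> R)
    (a b c d : C) (n : Z) (Y Z : R -> R * R) :
  mu0 <> 0 -> symmetric_medium L e0 eps ->
  is_transfer_matrix mu0 eps omega (matrix2 a b c d) ->
  (forall x, solves_at (mu0 * omega ^ 2) eps Y x) ->
  (forall x, solves_at (mu0 * omega ^ 2) eps Z x) ->
  let u n := complex_solution Y Z (IZR n) in
  let du n := (RtoC e0 * complex_flux Y Z (IZR n))%C in
  (u (n + 1)%Z = a * u n + b * du n /\ du (n + 1)%Z = c * u n + d * du n)%C.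
Proof.
  intros Hmu HM HT HY HZ u du.
  assert (HCD : forall n, CDerive (complex_solution Y Z) (IZR n) = du n).
  { intros k.
    destruct (locally_value_constant eps (IZR k) e0 (medium_integer _ _ _ HM k))
      as [E Hc].
    rewrite (complex_solution_CDerive (mu0 * omega ^ 2) eps) by auto.
    rewrite E. unfold du, complex_flux, Cmult, RtoC; simpl. f_equal; ring. }
  assert (HS := HT (complex_solution Y Z)).
  lapply HS; [clear HS; intros HS|].
  - specialize (HS n). unfold state in HS.
    change (vector2 (u (n + 1)%Z) (CDerive (complex_solution Y Z) (IZR (n + 1))) =
      Mmult (matrix2 a b c d)
        (vector2 (u n) (CDerive (complex_solution Y Z) (IZR n)))) in HS.
    rewrite !HCD, Mmult_vector2 in HS. now apply vector2_inj in HS.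
  - apply helmholtz_complex_solution; auto.
    + intros x. apply (medium_neq0 L e0 eps x HM).
    + intros x. apply (layered_even_locally_constant L); apply HM.
Qed.

Lemma zero_solves_at (q : R) (eps : R -> R) (x : R) :
  solves_at q eps (fun _ => (0, 0)) x.
Proof.
  split; [split; apply continuous_const|]. intros _. simpl.
  rewrite !Rmult_0_r. split; apply (is_derive_const (V := R_NormedModule)).
Qed.

(** Up to factors [e0], the columns of the transfer matrix are the states at
    [1] of the fundamental solutions, and the determinant is their Wronskian. *)
Lemma transfer_det (L : layering) (mu0 omega e0 : R) (eps : R -> R)
    (a b c d : C) :
  mu0 <> 0 -> symmetric_medium L e0 eps ->
  is_transfer_matrix mu0 eps omega (matrix2 a b c d) ->
  (a * d - b * c = 1)%C.
Proof.
  intros Hmu HM HT. set (q := mu0 * omega ^ 2).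
  assert (He0 := medium_e0_neq0 _ _ _ HM).
  assert (HS : forall y x, solves_at q eps (line_solution L q y) x)
    by (intros; apply line_solution_solves; apply HM).
  assert (HH := fun y =>
    solves_half_line L q eps _ (medium_layered _ _ _ HM) (HS y)).
  assert (W := wronskian_const _ _ _ _ _ _ (HH (1, 0)) (HH (0, 1)) 1 ltac:(lra)).
  simpl in W. rewrite !line_solution_0 in W. simpl in W.
  destruct (transfer_complex_solution L mu0 omega e0 eps a b c d
    0 (line_solution L q (1, 0)) (fun _ => (0, 0)) Hmu HM HT (HS _)
    (zero_solves_at _ _)) as [A C0].
  destruct (transfer_complex_solution L mu0 omega e0 eps a b c d
    0 (line_solution L q (0, 1)) (fun _ => (0, 0)) Hmu HM HT (HS _)
    (zero_solves_at _ _)) as [B D].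
  unfold complex_solution, complex_flux in *. simpl in *.
  rewrite !line_solution_0 in *. simpl in *.
  change (RtoC (fst (line_solution L q (1, 0) 1)) =
    a * 1 + b * (RtoC e0 * 0))%C in A.
  change (RtoC e0 * RtoC (snd (line_solution L q (1, 0) 1)) =
    c * 1 + d * (RtoC e0 * 0))%C in C0.
  change (RtoC (fst (line_solution L q (0, 1) 1)) =
    a * 0 + b * (RtoC e0 * 1))%C in B.
  change (RtoC e0 * RtoC (snd (line_solution L q (0, 1) 1)) =
    c * 0 + d * (RtoC e0 * 1))%C in D.
  set (p := fst (line_solution L q (1, 0) 1)) in *.
  set (p' := snd (line_solution L q (1, 0) 1)) in *.
  set (r := fst (line_solution L q (0, 1) 1)) in *.
  set (r' := snd (line_solution L q (0, 1) 1)) in *.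
  assert (He : RtoC e0 <> 0%C) by (intros H; apply He0; now inversion H).
  assert (Ea : a = RtoC p) by (rewrite A; ring).
  assert (Ec : c = (RtoC e0 * RtoC p')%C) by (rewrite C0; ring).
  assert (Eb : b = (RtoC r / RtoC e0)%C) by (rewrite B; field; exact He).
  assert (Ed : d = RtoC r').
  { transitivity ((RtoC e0 * RtoC r') / RtoC e0)%C; [rewrite D|]; field; exact He. }
  rewrite Ea, Eb, Ec, Ed.
  transitivity (RtoC (p * r' - r * p')).
  - rewrite RtoC_minus, !RtoC_mult. field. exact He.
  - rewrite W. f_equal. ring.
Qed.

(** [half_line_solution] for complex-valued functions, by real and imaginary
    parts. *)
Definition complex_half_line (L : layering) (q : R) (u w : R -> C) : Prop :=
  half_line_solution L q (fun x => Re (u x)) (fun x => Re (w x)) /\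
  half_line_solution L q (fun x => Im (u x)) (fun x => Im (w x)).

Lemma complex_half_line_eq (L : layering) (q : R) (eps : R -> R) (u w : R -> C)
    (Y Z : R -> R * R) :
  layered L eps -> (forall t, eps (- t) = eps t) ->
  complex_half_line L q u w ->
  (forall x, solves_at q eps Y x) -> (forall x, solves_at q eps Z x) ->
  u 0 = complex_solution Y Z 0 -> w 0 = complex_flux Y Z 0 ->
  forall x, 0 <= x -> u x = complex_solution Y Z x /\ w x = complex_flux Y Z x.
Proof.
  intros HL He [H1 H2] HY HZ E1 E2 x Hx.
  assert (HY' := solves_half_line L q eps Y HL HY).
  assert (HZ' := solves_half_line L q eps Z HL HZ).
  destruct (half_line_unique L q eps _ _ _ _ HL He H1 HY') with (x := x)
    as [A1 A2]; try (rewrite ?E1, ?E2; reflexivity); auto.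
  destruct (half_line_unique L q eps _ _ _ _ HL He H2 HZ') with (x := x)
    as [A3 A4]; try (rewrite ?E1, ?E2; reflexivity); auto.
  unfold complex_solution, complex_flux. simpl in *.
  rewrite <- A1, <- A2, <- A3, <- A4.
  split; apply surjective_pairing.
Qed.

(** On the right half-line [u] coincides with a solution on the whole line,
    to which the transfer matrix applies. *)
Lemma transfer_right (L : layering) (mu0 omega e0 : R) (eps : R -> R)
    (a b c d : C) (u w : R -> C) (n : nat) :
  mu0 <> 0 -> symmetric_medium L e0 eps ->
  is_transfer_matrix mu0 eps omega (matrix2 a b c d) ->
  complex_half_line L (mu0 * omega ^ 2) u w ->
  let X n := u (IZR (Z.of_nat n)) in
  let Y n := (RtoC e0 * w (IZR (Z.of_nat n)))%C in
  (X (S n) = a * X n + b * Y n /\ Y (S n) = c * X n + d * Y n)%C.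
Proof.
  intros Hmu HM HT Hu X Y.
  set (q := mu0 * omega ^ 2) in *.
  set (V := line_solution L q (Re (u 0), Re (w 0))).
  set (W := line_solution L q (Im (u 0), Im (w 0))).
  assert (HV : forall x, solves_at q eps V x)
    by (intros; apply line_solution_solves; apply HM).
  assert (HW : forall x, solves_at q eps W x)
    by (intros; apply line_solution_solves; apply HM).
  assert (E := complex_half_line_eq L q eps u w V W (medium_layered _ _ _ HM)
    (medium_even _ _ _ HM) Hu HV HW).
  assert (H0 : V 0 = (Re (u 0), Re (w 0)) /\ W 0 = (Im (u 0), Im (w 0)))
    by (split; apply line_solution_0).
  destruct H0 as [HV0 HW0].
  lapply E; [clear E; intros E|].
  2: { unfold complex_solution. rewrite HV0, HW0. now destruct (u 0). }
  lapply E; [clear E; intros E|].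
  2: { unfold complex_flux. rewrite HV0, HW0. now destruct (w 0). }
  assert (Hn : forall k, 0 <= IZR (Z.of_nat k)) by (intros; apply IZR_le; lia).
  destruct (E _ (Hn n)) as [Eu Ew]. destruct (E _ (Hn (S n))) as [EuS EwS].
  unfold X, Y. rewrite Eu, Ew, EuS, EwS.
  replace (Z.of_nat (S n)) with (Z.of_nat n + 1)%Z by lia.
  exact (transfer_complex_solution L mu0 omega e0 eps a b c d (Z.of_nat n) V W
    Hmu HM HT HV HW).
Qed.

(** The hypothesis on [u] is that its reflection solves the system on the
    right half-line. *)
Lemma transfer_left (L : layering) (mu0 omega e0 : R) (eps : R -> R)
    (a b c d : C) (u w : R -> C) (n : nat) :
  mu0 <> 0 -> symmetric_medium L e0 eps ->
  is_transfer_matrix mu0 eps omega (matrix2 a b c d) ->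
  complex_half_line L (mu0 * omega ^ 2) (fun x => u (- x))
    (fun x => - w (- x)%R)%C ->
  let X n := u (IZR (- Z.of_nat n)) in
  let Y n := (RtoC e0 * w (IZR (- Z.of_nat n)))%C in
  (X n = a * X (S n) + b * Y (S n) /\ Y n = c * X (S n) + d * Y (S n))%C.
Proof.
  intros Hmu HM HT Hu X Y.
  set (q := mu0 * omega ^ 2) in *.
  set (V := line_solution L q (Re (u 0), Re (w 0))).
  set (W := line_solution L q (Im (u 0), Im (w 0))).
  assert (HV : forall x, solves_at q eps V x)
    by (intros; apply line_solution_solves; apply HM).
  assert (HW : forall x, solves_at q eps W x)
    by (intros; apply line_solution_solves; apply HM).
  assert (E := complex_half_line_eq L q eps _ _ (reflect V) (reflect W)
    (medium_layered _ _ _ HM) (medium_even _ _ _ HM) Hu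
    (fun x => solves_at_reflect q eps V x (medium_even _ _ _ HM) (HV (- x)))
    (fun x => solves_at_reflect q eps W x (medium_even _ _ _ HM) (HW (- x)))).
  assert (H0 : V 0 = (Re (u 0), Re (w 0)) /\ W 0 = (Im (u 0), Im (w 0)))
    by (split; apply line_solution_0).
  destruct H0 as [HV0 HW0].
  cbv beta in E. rewrite Ropp_0 in E.
  lapply E; [clear E; intros E|].
  2: { unfold complex_solution, reflect. rewrite Ropp_0, HV0, HW0.
       now destruct (u 0). }
  lapply E; [clear E; intros E|].
  2: { unfold complex_flux, reflect. rewrite Ropp_0, HV0, HW0. reflexivity. }
  assert (E' : forall k : nat, X k = complex_solution V W (IZR (- Z.of_nat k)) /\
    w (IZR (- Z.of_nat k)) = complex_flux V W (IZR (- Z.of_nat k))).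
  { intros k. destruct (E (IZR (Z.of_nat k))) as [E1 E2]; [apply IZR_le; lia|].
    unfold X. rewrite opp_IZR. split; [exact E1|].
    transitivity (- - w (- IZR (Z.of_nat k))%R)%C; [ring|]. rewrite E2.
    unfold complex_flux, reflect, Copp. simpl. now rewrite !Ropp_involutive. }
  destruct (E' n) as [Eu Ew]. destruct (E' (S n)) as [EuS EwS].
  unfold Y. rewrite Eu, Ew, EuS, EwS.
  replace (- Z.of_nat n)%Z with (- Z.of_nat (S n) + 1)%Z by lia.
  exact (transfer_complex_solution L mu0 omega e0 eps a b c d
    (- Z.of_nat (S n)) V W Hmu HM HT HV HW).
Qed.

(** * Decaying orbits of a unimodular matrix *)

Lemma Cminus_eq_0 (x y : C) : (x - y = 0)%C -> x = y.
Proof.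
  intros H. replace x with (x - y + y)%C by ring. rewrite H. ring.
Qed.

(** Eigenvalues are the roots of the characteristic polynomial. *)
Lemma is_eigenvalue_matrix2 (a b c d z : C) :
  is_eigenvalue (matrix2 a b c d) z <->
  (a * d - b * c - (a + d) * z + z * z = 0)%C.
Proof.
  split.
  - intros [v [Hv E]]. destruct (vector2_surj v) as [x [y ->]].
    rewrite Mmult_vector2 in E.
    change (vector2 (a * x + b * y)%C (c * x + d * y)%C =
      vector2 (z * x)%C (z * y)%C) in E.
    apply vector2_inj in E. destruct E as [E1 E2].
    (* Apply the adjugate of [T - z] to [(T - z) v = 0]. *)
    set (chi := (a * d - b * c - (a + d) * z + z * z)%C).
    assert (X : (chi * x = 0)%C).
    { replace (chi * x)%C with ((d - z) * (a * x + b * y - z * x) -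
        b * (c * x + d * y - z * y))%C by (unfold chi; ring).
      rewrite E1, E2. ring. }
    assert (Y : (chi * y = 0)%C).
    { replace (chi * y)%C with ((a - z) * (c * x + d * y - z * y) -
        c * (a * x + b * y - z * x))%C by (unfold chi; ring).
      rewrite E1, E2. ring. }
    destruct (Ceq_dec chi 0) as [|Hchi]; [assumption|exfalso]. apply Hv.
    assert (x = 0) as ->.
    { destruct (Ceq_dec x 0) as [|Hx]; [assumption|].
      now destruct (Cmult_neq_0 chi x Hchi Hx). }
    assert (y = 0) as ->.
    { destruct (Ceq_dec y 0) as [|Hy]; [assumption|].
      now destruct (Cmult_neq_0 chi y Hchi Hy). }
    reflexivity.
  - intros E.
    assert (H : forall x y : C, (x <> 0 \/ y <> 0)%C -> (a * x + b * y = z * x)%C ->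
      (c * x + d * y = z * y)%C -> is_eigenvalue (matrix2 a b c d) z).
    { intros x y Hxy E1 E2. exists (vector2 x y). split.
      - intros H0. change (vector2 x y = vector2 0 0) in H0.
        apply vector2_inj in H0. tauto.
      - rewrite Mmult_vector2, E1, E2. reflexivity. }
    (* The vector [(b, z - a)] or [(z - d, c)] is an eigenvector unless it
       vanishes; a diagonal matrix is left over. *)
    destruct (Ceq_dec b 0) as [->|Hb].
    + destruct (Ceq_dec c 0) as [->|Hc].
      * assert (E' : ((z - a) * (z - d) = 0)%C) by (rewrite <- E; ring).
        destruct (Ceq_dec z a) as [->|Ha].
        -- apply (H 1 0); [left; apply C1_nz|ring|ring].
        -- apply (H 0 1); [right; apply C1_nz|ring|].
           assert (z = d) as ->; [|ring].
           destruct (Ceq_dec z d) as [|Hd]; [assumption|].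
           destruct (Cmult_neq_0 (z - a) (z - d)); [| |exact E'];
             intros H0; apply Cminus_eq_0 in H0; auto.
      * apply (H (z - d)%C c); [now right| |ring].
        replace (z * (z - d))%C with
          ((a * (z - d) + 0 * c) + (a * d - 0 * c - (a + d) * z + z * z))%C by ring.
        rewrite E. ring.
    + apply (H b (z - a)%C); [now left|ring|].
      replace (z * (z - a))%C with
        ((c * b + d * (z - a)) + (a * d - b * c - (a + d) * z + z * z))%C by ring.
      rewrite E. ring.
Qed.

(** The product of the eigenvalues is [1], so two distinct ones cannot both
    have modulus less than [1]. *)
Lemma is_lambda1_matrix2 (a b c d lambda : C) :
  (a * d - b * c = 1)%C -> Cmod lambda < 1 ->
  (a * d - b * c - (a + d) * lambda + lambda * lambda = 0)%C ->
  is_lambda1 (matrix2 a b c d) lambda.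
Proof.
  intros Hdet Hlt Hl. split.
  - split; [|exact Hlt]. now apply is_eigenvalue_matrix2.
  - intros z [Hz Hzlt]. apply is_eigenvalue_matrix2 in Hz.
    destruct (Ceq_dec lambda z) as [|Hne]; [assumption|exfalso].
    assert (E : (lambda * z = 1)%C).
    { assert (E' : ((lambda - z) * (lambda + z - (a + d)) = 0)%C).
      { replace ((lambda - z) * (lambda + z - (a + d)))%C with
         ((a * d - b * c - (a + d) * lambda + lambda * lambda) -
          (a * d - b * c - (a + d) * z + z * z))%C by ring.
        rewrite Hl, Hz. ring. }
      assert (Ez : (lambda + z - (a + d) = 0)%C).
      { destruct (Ceq_dec (lambda + z - (a + d)) 0) as [|H0]; [assumption|].
        destruct (Cmult_neq_0 (lambda - z) (lambda + z - (a + d))); auto.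
        intros H1. apply Cminus_eq_0 in H1. auto. }
      replace (lambda * z)%C with
        ((a * d - b * c) - (a * d - b * c - (a + d) * lambda + lambda * lambda) +
         lambda * (lambda + z - (a + d)))%C by ring.
      rewrite Hl, Ez, Hdet. ring. }
    apply (f_equal Cmod) in E. rewrite Cmod_mult, Cmod_1 in E.
    assert (H1 := Cmod_ge_0 lambda). assert (H2 := Cmod_ge_0 z). nra.
Qed.

Lemma decaying_geometric (lambda x : C) (X : nat -> C) :
  x <> 0 -> (forall n, X n = lambda ^ n * x)%C ->
  is_lim_seq (fun n => Cmod (X n)) 0 -> Cmod lambda < 1.
Proof.
  intros Hx HX Hlim. destruct (Rlt_le_dec (Cmod lambda) 1) as [|Hge]; [assumption|].
  exfalso. apply Cmod_gt_0 in Hx.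
  assert (H : Rbar_le (Cmod x) 0).
  { apply (is_lim_seq_le (fun _ => Cmod x) (fun n => Cmod (X n)));
      [|apply is_lim_seq_const|exact Hlim].
    intros n. rewrite HX, Cmod_mult, Cmod_pow.
    assert (H1 := pow_R1_Rle (Cmod lambda) n Hge). nra. }
  simpl in H. lra.
Qed.

(** A non-zero orbit that tends to [0] under a matrix of determinant [1] is
    geometric, with ratio an eigenvalue of modulus less than [1]. *)
Lemma decaying_orbit (a b c d : C) (X Y : nat -> C) :
  (a * d - b * c = 1)%C ->
  (forall n, X (S n) = a * X n + b * Y n /\ Y (S n) = c * X n + d * Y n)%C ->
  is_lim_seq (fun n => Cmod (X n)) 0 -> is_lim_seq (fun n => Cmod (Y n)) 0 ->
  X 0%nat <> 0 \/ Y 0%nat <> 0 ->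
  exists lambda : C, Cmod lambda < 1 /\
    (a * d - b * c - (a + d) * lambda + lambda * lambda = 0)%C /\
    forall n, (X n = lambda ^ n * X 0%nat /\ Y n = lambda ^ n * Y 0%nat)%C.
Proof.
  intros Hdet Hstep HX HY H0.
  assert (Hw : forall n, (X n * Y (S n) - Y n * X (S n) =
    X 0%nat * Y 1%nat - Y 0%nat * X 1%nat)%C).
  { induction n as [|n IH]; [reflexivity|]. rewrite <- IH.
    destruct (Hstep (S n)) as [-> ->].
    destruct (Hstep n) as [-> ->].
    set (x := X n). set (y := Y n).
    transitivity ((a * d - b * c) * (x * (c * x + d * y) - y * (a * x + b * y)))%C;
      [ring|]. rewrite Hdet. ring. }
  (* A constant determinant whose factors tend to [0] is [0]. *)
  assert (Hw0 : (X 0%nat * Y 1%nat - Y 0%nat * X 1%nat = 0)%C).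
  { apply Cmod_eq_0. apply Rle_antisym; [|apply Cmod_ge_0].
    assert (H : Rbar_le (Cmod (X 0%nat * Y 1%nat - Y 0%nat * X 1%nat)%C)
      (0 * 0 + 0 * 0)).
    { assert (HX1 := proj1 (is_lim_seq_incr_1 _ _) HX).
      assert (HY1 := proj1 (is_lim_seq_incr_1 _ _) HY).
      apply (is_lim_seq_le (fun _ => Cmod (X 0%nat * Y 1%nat - Y 0%nat * X 1%nat)%C)
        (fun n => Cmod (X n) * Cmod (Y (S n)) + Cmod (Y n) * Cmod (X (S n)))).
      - intros n. rewrite <- (Hw n). unfold Cminus.
        eapply Rle_trans; [apply Cmod_triangle|].
        rewrite Cmod_opp, !Cmod_mult. lra.
      - apply is_lim_seq_const.
      - apply is_lim_seq_plus'; now apply is_lim_seq_mult'. }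
    simpl in H. lra. }
  assert (Hl : exists lambda, (X 1%nat = lambda * X 0%nat /\
    Y 1%nat = lambda * Y 0%nat)%C).
  { apply Cminus_eq_0 in Hw0.
    destruct (Ceq_dec (X 0%nat) 0) as [Ex|Hx].
    - destruct H0 as [H0|Hy]; [contradiction|].
      exists (Y 1%nat / Y 0%nat)%C. split; [|field; exact Hy].
      rewrite Ex in *. rewrite Cmult_0_l in Hw0. symmetry in Hw0.
      destruct (Ceq_dec (X 1%nat) 0) as [->|H1]; [ring|].
      now destruct (Cmult_neq_0 _ _ Hy H1).
    - exists (X 1%nat / X 0%nat)%C. split; [field; exact Hx|].
      replace (Y 1%nat) with (X 0%nat * Y 1%nat / X 0%nat)%C by (field; exact Hx).
      rewrite Hw0. field. exact Hx. }
  destruct Hl as [lambda [E1 E2]]. exists lambda.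
  assert (Hpow : forall n, (X n = lambda ^ n * X 0%nat /\
    Y n = lambda ^ n * Y 0%nat)%C).
  { destruct (Hstep 0%nat) as [S1 S2]. rewrite S1 in E1. rewrite S2 in E2.
    induction n as [|n [IH1 IH2]]; [split; simpl; ring|].
    destruct (Hstep n) as [-> ->]. rewrite IH1, IH2. simpl. split.
    - transitivity (lambda ^ n * (a * X 0%nat + b * Y 0%nat))%C; [ring|].
      rewrite E1. ring.
    - transitivity (lambda ^ n * (c * X 0%nat + d * Y 0%nat))%C; [ring|].
      rewrite E2. ring. }
  split; [|split]; [| |exact Hpow].
  - destruct H0 as [H0|H0].
    + apply (decaying_geometric lambda (X 0%nat) X); auto. apply Hpow.
    + apply (decaying_geometric lambda (Y 0%nat) Y); auto. apply Hpow.
  - apply is_eigenvalue_matrix2. exists (vector2 (X 0%nat) (Y 0%nat)). split.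
    + intros H. change (vector2 (X 0%nat) (Y 0%nat) = vector2 0 0) in H.
      apply vector2_inj in H. tauto.
    + rewrite Mmult_vector2. destruct (Hstep 0%nat) as [<- <-].
      rewrite E1, E2. reflexivity.
Qed.

(** * Decay of localised eigenmodes *)

(** [u] with flux [w] solves the system wherever [eps] is locally constant. *)
Definition first_order_solution (q : R) (eps : R -> R) (u w : R -> C) : Prop :=
  (forall x, @continuous R_UniformSpace C_R_NormedModule u x) /\
  (forall x, @continuous R_UniformSpace C_R_NormedModule w x) /\
  forall x, locally_constant eps x -> eps x <> 0 -> first_order_at q eps u w x.

Lemma helmholtz_first_order_solution (mu0 omega : R) (eps : R -> R) (u : R -> C) :
  mu0 <> 0 -> helmholtz_solution mu0 eps omega u ->
  exists w, first_order_solution (mu0 * omega ^ 2) eps u w.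
Proof.
  intros Hmu [Hu [[w [Hw Hf]] Hd]]. exists w. split; [|split]; auto.
  intros x Hc H0.
  destruct (Hd x (locally_constant_continuous eps x Hc)) as [D1 [D2 D3]].
  now apply helmholtz_first_order.
Qed.

Lemma first_order_right (L : layering) (q : R) (eps : R -> R) (u w : R -> C) :
  layered L eps -> (forall m, layer_coef L m <> 0) ->
  first_order_solution q eps u w -> complex_half_line L q u w.
Proof.
  intros HL H0 [Hu [Hw Hd]].
  assert (D : forall m x, interface L m < x < interface L (S m) ->
    first_order_at q eps u w x).
  { intros m x Hx. apply Hd; [now apply (layered_locally_constant L _ m)|].
    rewrite (HL m x Hx). apply H0. }
  split; (split; [intros x; split; auto using continuous_Re, continuous_Im|]);
    intros m x Hx; destruct (D m x Hx) as [_ D']; rewrite (HL m x Hx) in D'; tauto.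
Qed.

Lemma first_order_left (L : layering) (q : R) (eps : R -> R) (u w : R -> C) :
  layered L (fun x => eps (- x)) -> (forall m, layer_coef L m <> 0) ->
  first_order_solution q eps u w ->
  complex_half_line L q (fun x => u (- x)) (fun x => - w (- x)%R)%C.
Proof.
  intros HL H0 [Hu [Hw Hd]].
  assert (D : forall m x, interface L m < x < interface L (S m) ->
    first_order_at q eps u w (- x)).
  { intros m x Hx. apply Hd; [|rewrite (HL m x Hx); apply H0].
    assert (Hc := layered_locally_constant L _ m x HL Hx).
    unfold locally_constant in *.
    assert (Hc' : locally (- x) (fun t => eps (- - t) = eps (- x)))
      by (apply (locally_opp (- x) (fun t => eps (- t) = eps (- x)));
          rewrite Ropp_involutive; exact Hc).
    revert Hc'. apply filter_imp. intros t. now rewrite Ropp_involutive. }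
  assert (K : forall U P : R -> R, forall e x,
    is_derive U (- x) (e * P (- x)) /\ is_derive P (- x) (- q * U (- x)) ->
    is_derive (fun t => U (- t)) x (e * - P (- x)) /\
    is_derive (fun t => - P (- t)) x (- q * U (- x))).
  { intros U P e x [D1 D2]. split.
    - replace (e * - P (- x)) with (- (e * P (- x))) by ring.
      now apply is_derive_reflect.
    - apply is_derive_reflect in D2.
      apply (is_derive_opp (V := R_NormedModule)) in D2.
      rewrite Ropp_involutive in D2. exact D2. }
  split; split.
  - intros x. split.
    + apply (continuous_reflect (fun t => Re (u t))), continuous_Re, Hu.
    + apply (continuous_opp (V := R_NormedModule) (fun t => Re (w (- t)))).
      apply (continuous_reflect (fun t => Re (w t))), continuous_Re, Hw.
  - intros m x Hx. destruct (D m x Hx) as [_ [D' _]]. rewrite (HL m x Hx) in D'.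
    exact (K (fun t => Re (u t)) (fun t => Re (w t)) _ x D').
  - intros x. split.
    + apply (continuous_reflect (fun t => Im (u t))), continuous_Im, Hu.
    + apply (continuous_opp (V := R_NormedModule) (fun t => Im (w (- t)))).
      apply (continuous_reflect (fun t => Im (w t))), continuous_Im, Hw.
  - intros m x Hx. destruct (D m x Hx) as [_ [_ D']]. rewrite (HL m x Hx) in D'.
    exact (K (fun t => Im (u t)) (fun t => Im (w t)) _ x D').
Qed.

Lemma complex_half_line_zero (L : layering) (q : R) (eps : R -> R) (u w : R -> C) :
  layered L eps -> (forall t, eps (- t) = eps t) ->
  complex_half_line L q u w -> u 0 = 0 -> w 0 = 0 ->
  forall x, 0 <= x -> u x = 0.
Proof.
  intros HL He H E1 E2 x Hx.
  apply (complex_half_line_eq L q eps u w (fun _ => (0, 0)) (fun _ => (0, 0)));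
    auto using zero_solves_at.
Qed.

Lemma decaying_right (L : layering) (mu0 omega e0 : R) (eps : R -> R)
    (T : @matrix C 2 2) (u w : R -> C) :
  mu0 <> 0 -> symmetric_medium L e0 eps -> is_transfer_matrix mu0 eps omega T ->
  complex_half_line L (mu0 * omega ^ 2) u w -> u 0 <> 0 \/ w 0 <> 0 ->
  let X n := u (IZR (Z.of_nat n)) in
  let Y n := (RtoC e0 * w (IZR (Z.of_nat n)))%C in
  is_lim_seq (fun n => Cmod (X n)) 0 -> is_lim_seq (fun n => Cmod (Y n)) 0 ->
  exists lambda, is_lambda1 T lambda /\
    forall n, (X n = lambda ^ n * X 0%nat /\ Y n = lambda ^ n * Y 0%nat)%C.
Proof.
  intros Hmu HM HT Hu H0 X Y HX HY.
  destruct (matrix2_surj T) as [a [b [c [d ->]]]].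
  assert (Hdet := transfer_det L mu0 omega e0 eps a b c d Hmu HM HT).
  destruct (decaying_orbit a b c d X Y) as [lambda [Hlt [Hl Hpow]]]; auto.
  - intros n. exact (transfer_right L mu0 omega e0 eps a b c d u w n Hmu HM HT Hu).
  - destruct H0 as [H0|H0]; [now left|right]. apply Cmult_neq_0; [|exact H0].
    intros H. apply (medium_e0_neq0 _ _ _ HM). now inversion H.
  - exists lambda. split; [|exact Hpow]. now apply is_lambda1_matrix2.
Qed.

(** The orbit runs under the inverse of [T], that is its adjugate. *)
Lemma decaying_left (L : layering) (mu0 omega e0 : R) (eps : R -> R)
    (T : @matrix C 2 2) (u w : R -> C) :
  mu0 <> 0 -> symmetric_medium L e0 eps -> is_transfer_matrix mu0 eps omega T ->
  complex_half_line L (mu0 * omega ^ 2) (fun x => u (- x))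
    (fun x => - w (- x)%R)%C ->
  u 0 <> 0 \/ w 0 <> 0 ->
  let X n := u (IZR (- Z.of_nat n)) in
  let Y n := (RtoC e0 * w (IZR (- Z.of_nat n)))%C in
  is_lim_seq (fun n => Cmod (X n)) 0 -> is_lim_seq (fun n => Cmod (Y n)) 0 ->
  exists lambda, is_lambda1 T lambda /\
    forall n, (X n = lambda ^ n * X 0%nat /\ Y n = lambda ^ n * Y 0%nat)%C.
Proof.
  intros Hmu HM HT Hu H0 X Y HX HY.
  destruct (matrix2_surj T) as [a [b [c [d ->]]]].
  assert (Hdet := transfer_det L mu0 omega e0 eps a b c d Hmu HM HT).
  destruct (decaying_orbit d (- b) (- c) a X Y) as [lambda [Hlt [Hl Hpow]]]; auto.
  - rewrite <- Hdet. ring.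
  - intros n.
    destruct (transfer_left L mu0 omega e0 eps a b c d u w n Hmu HM HT Hu)
      as [E1 E2].
    fold (X n) (Y n) (X (S n)) (Y (S n)) in E1, E2. rewrite E1, E2. split.
    + transitivity ((a * d - b * c) * X (S n))%C; [rewrite Hdet|]; ring.
    + transitivity ((a * d - b * c) * Y (S n))%C; [rewrite Hdet|]; ring.
  - destruct H0 as [H0|H0]; [now left|right]. apply Cmult_neq_0; [|exact H0].
    intros H. apply (medium_e0_neq0 _ _ _ HM). now inversion H.
  - exists lambda. split; [|exact Hpow]. apply is_lambda1_matrix2; auto.
    rewrite <- Hl. ring.
Qed.

Lemma locally_Cmod_lt (e : posreal) :
  @locally C_R_NormedModule (RtoC 0) (fun z => Cmod z < e).
Proof.
  exists (pos_div_2 e). intros z [H1 H2].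
  unfold ball in H1, H2; simpl in H1, H2.
  unfold AbsRing_ball, abs, minus, plus, opp in H1, H2; simpl in H1, H2.
  rewrite Ropp_0, Rplus_0_r in H1, H2.
  assert (H := Cmod_2Rmax z).
  assert (Hm : Rmax (Rabs (fst z)) (Rabs (snd z)) < e / 2) by now apply Rmax_lub_lt.
  assert (He := cond_pos e).
  assert (Hs : sqrt 2 < 2).
  { rewrite <- (sqrt_square 2) at 2 by lra. apply sqrt_lt_1; lra. }
  assert (Hs0 := sqrt_pos 2).
  assert (Hm0 : 0 <= Rmax (Rabs (fst z)) (Rabs (snd z)))
    by (eapply Rle_trans; [apply Rabs_pos|apply Rmax_l]).
  nra.
Qed.

Lemma Cmod_lim_seq (f : nat -> C) :
  (forall e : posreal, exists N, forall n, (N <= n)%nat -> Cmod (f n) < e) ->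
  is_lim_seq (fun n => Cmod (f n)) 0.
Proof.
  intros H. apply is_lim_seq_spec. intros e. destruct (H e) as [N HN].
  exists N. intros n Hn. rewrite Rminus_0_r, Rabs_pos_eq by apply Cmod_ge_0. auto.
Qed.

Lemma Z_p_infty_lim_seq (f : Z -> C) :
  filterlim f Z_p_infty (@locally C_R_NormedModule (RtoC 0)) ->
  is_lim_seq (fun n => Cmod (f (Z.of_nat n))) 0.
Proof.
  intros H. apply Cmod_lim_seq. intros e.
  destruct (H _ (locally_Cmod_lt e)) as [M HM].
  exists (Z.to_nat M). intros n Hn. apply HM. lia.
Qed.

Lemma Z_m_infty_lim_seq (f : Z -> C) :
  filterlim f Z_m_infty (@locally C_R_NormedModule (RtoC 0)) ->
  is_lim_seq (fun n => Cmod (f (- Z.of_nat n)%Z)) 0.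
Proof.
  intros H. apply Cmod_lim_seq. intros e.
  destruct (H _ (locally_Cmod_lt e)) as [M HM].
  exists (Z.to_nat (- M)). intros n Hn. apply HM. lia.
Qed.

Lemma geometric_bound (lambda z x : C) (n : nat) :
  z = (lambda ^ n * x)%C -> Cmod z <= Cmod x * Rabs (Cmod lambda ^ n).
Proof.
  intros ->. rewrite Cmod_mult, Cmod_pow, Rabs_pos_eq; [lra|].
  apply pow_le, Cmod_ge_0.
Qed.

Lemma is_bigO_right (f : Z -> C) (lambda x : C) :
  (forall n : nat, f (Z.of_nat n) = lambda ^ n * x)%C ->
  is_bigO Z_p_infty f (fun n => Cmod lambda ^ Z.abs_nat n).
Proof.
  intros H. exists (Cmod x), 0%Z. intros n Hn. apply geometric_bound.
  rewrite <- H. f_equal. lia.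
Qed.

Lemma is_bigO_left (f : Z -> C) (lambda x : C) :
  (forall n : nat, f (- Z.of_nat n)%Z = lambda ^ n * x)%C ->
  is_bigO Z_m_infty f (fun n => Cmod lambda ^ Z.abs_nat n).
Proof.
  intros H. exists (Cmod x), 0%Z. intros n Hn. apply geometric_bound.
  rewrite <- H. f_equal. lia.
Qed.

Theorem corollary5p2p1 (mu0 : R) (Omega : R -> Prop) (eps1 eps2 : R -> R)
  (gA gB : geometry) (epsA epsB : R -> R -> R)
  (omega : R) (TA TB : @matrix C 2 2) (u : R -> C)
  (mu0_pos : 0 < mu0)
  (eps1_cont : forall w : R, Omega w -> continuous eps1 w)
  (eps2_cont : forall w : R, Omega w -> continuous eps2 w)
  (eps1_neq0 : forall w : R, Omega w -> eps1 w <> 0)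
  (eps2_neq0 : forall w : R, Omega w -> eps2 w <> 0)
  (materialA : material_permittivity gA eps1 eps2 epsA)
  (materialB : material_permittivity gB eps1 eps2 epsB)
  (omega_Omega : Omega omega)
  (transferA : is_transfer_matrix mu0 (fun x => epsA x omega) omega TA)
  (transferB : is_transfer_matrix mu0 (fun x => epsB x omega) omega TB)
  (eigenmode : localised_eigenmode mu0
     (fun x => joined_permittivity epsA epsB x omega) omega u) :
  exists lambdaA lambdaB : C,
    is_lambda1 TA lambdaA /\ is_lambda1 TB lambdaB /\
    is_bigO Z_m_infty (fun n => u (IZR n))
      (fun n => Cmod lambdaA ^ Z.abs_nat n) /\
    is_bigO Z_m_infty (fun n => CDerive u (IZR n))
      (fun n => Cmod lambdaA ^ Z.abs_nat n) /\
    is_bigO Z_p_infty (fun n => u (IZR n))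
      (fun n => Cmod lambdaB ^ Z.abs_nat n) /\
    is_bigO Z_p_infty (fun n => CDerive u (IZR n))
      (fun n => Cmod lambdaB ^ Z.abs_nat n).
Proof.
  assert (Hmu : mu0 <> 0) by lra.
  assert (H1 := eps1_neq0 omega omega_Omega).
  assert (H2 := eps2_neq0 omega omega_Omega).
  assert (MA := material_symmetric_medium gA eps1 eps2 epsA omega H1 H2 materialA).
  assert (MB := material_symmetric_medium gB eps1 eps2 epsB omega H1 H2 materialB).
  set (LA := material_layering gA (eps1 omega) (eps2 omega)) in *.
  set (LB := material_layering gB (eps1 omega) (eps2 omega)) in *.
  set (q := mu0 * omega ^ 2).
  set (eps := fun x => joined_permittivity epsA epsB x omega) in *.
  destruct eigenmode as [Hsol [[x0 Hx0] [Lu_r [Ldu_r [Lu_l Ldu_l]]]]].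
  destruct (helmholtz_first_order_solution mu0 omega eps u Hmu Hsol) as [w Hw].
  assert (HLB : layered LB eps).
  { intros m x Hx. unfold eps, joined_permittivity.
    assert (Hm := interface_ge0 LB m).
    destruct Rlt_dec; [lra|]. now apply (medium_layered _ _ _ MB). }
  assert (HLA : layered LA (fun x => eps (- x))).
  { intros m x Hx. unfold eps, joined_permittivity.
    assert (Hm := interface_ge0 LA m).
    destruct Rlt_dec; [|lra].
    rewrite (medium_even _ _ _ MA). now apply (medium_layered _ _ _ MA). }
  assert (HB := first_order_right LB q eps u w HLB (medium_coef _ _ _ MB) Hw).
  assert (HA := first_order_left LA q eps u w HLA (medium_coef _ _ _ MA) Hw).
  assert (HD : forall n : Z, CDerive u (IZR n) = (RtoC (eps1 omega) * w (IZR n))%C).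
  { intros n.
    (* Both materials equal [eps1 omega] around [n], also for [n = 0]. *)
    assert (Hn : locally (IZR n) (fun t => eps t = eps1 omega)).
    { generalize (filter_and _ _ (medium_integer _ _ _ MA n)
        (medium_integer _ _ _ MB n)).
      apply filter_imp. intros t [EA EB]. unfold eps, joined_permittivity.
      now destruct Rlt_dec. }
    destruct (locally_value_constant _ _ _ Hn) as [E Hc].
    destruct Hw as [_ [_ Hw]].
    destruct (Hw (IZR n) Hc) as [Hd _]; [now rewrite E|]. now rewrite Hd, E. }
  assert (H0 : u 0 <> 0 \/ w 0 <> 0).
  { destruct (Ceq_dec (u 0) 0) as [Eu|]; [|now left].
    destruct (Ceq_dec (w 0) 0) as [Ew|]; [|now right].
    exfalso. apply Hx0. destruct (Rle_dec 0 x0) as [Hle|Hlt].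
    - apply (complex_half_line_zero LB q _ u w (medium_layered _ _ _ MB)
        (medium_even _ _ _ MB) HB Eu Ew x0 Hle).
    - rewrite <- (Ropp_involutive x0).
      apply (complex_half_line_zero LA q _ _ _ (medium_layered _ _ _ MA)
        (medium_even _ _ _ MA) HA); [now rewrite Ropp_0| |lra].
      rewrite Ropp_0, Ew. ring. }
  assert (Ldw_r := Z_p_infty_lim_seq _ Ldu_r).
  assert (Ldw_l := Z_m_infty_lim_seq _ Ldu_l).
  destruct (decaying_left LA mu0 omega (eps1 omega) _ TA u w Hmu MA transferA HA H0)
    as [lambdaA [HlA HpA]].
  { exact (Z_m_infty_lim_seq _ Lu_l). }
  { apply (is_lim_seq_ext _ _ _ (fun n => f_equal Cmod (HD (- Z.of_nat n)%Z)) Ldw_l). }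
  destruct (decaying_right LB mu0 omega (eps1 omega) _ TB u w Hmu MB transferB HB H0)
    as [lambdaB [HlB HpB]].
  { exact (Z_p_infty_lim_seq _ Lu_r). }
  { apply (is_lim_seq_ext _ _ _ (fun n => f_equal Cmod (HD (Z.of_nat n))) Ldw_r). }
  exists lambdaA, lambdaB.
  split; [exact HlA|]. split; [exact HlB|].
  split; [|split; [|split]].
  - eapply is_bigO_left. intros n. apply HpA.
  - eapply is_bigO_left. intros n. cbv beta. rewrite HD. apply HpA.
  - eapply is_bigO_right. intros n. apply HpB.
  - eapply is_bigO_right. intros n. cbv beta. rewrite HD. apply HpB.
Qed.
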